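(* Let $\mathbb{F}$ be a field, let $2\le k\le n$ be integers, and let $P_n$ be the graph consisting of $n$ isolated vertices (no edges). Then both Stanley-Reisner rings $\mathbb{F}[\Delta_k^t(P_n)]$ and $\mathbb{F}[\Delta_k^t(P_n)^\vee]$ are Cohen-Macaulay and have linear resolutions.
   Context: A simplicial complex on a finite set $V$ is a collection of subsets of $V$ closed under taking subsets (an element of $V$ need not itself be a face). Its Stanley-Reisner ring over $\mathbb{F}$ is $\mathbb{F}[\Delta]=S/I_\Delta$, where $S=\mathbb{F}[x_v : v\in V]$ and $I_\Delta$ is generated by the monomials $\prod_{v\in F}x_v$ for all $F\subseteq V$ with $F\notin\Delta$. For a finite simple graph $G=(V,E)$ and a positive integer $k$, $\Delta_k^t(G)$ is the simplicial complex on $V$ whose facets are the complements $V\setminus M$ of the independent sets $M\subseteq V$ of size $k$ (independent: no two elements adjacent). The Alexander dual of $\Delta$ is $\Delta^\vee=\{F\subseteq V : V\setminus F\notin\Delta\}$, a complex on the same set $V$. For a homogeneous ideal $I\subseteq S$, $\beta_{i,j}=\dim_{\mathbb{F}}\mathrm{Tor}^S_i(S/I,\mathbb{F})_j$ are the graded Betti numbers of $S/I$. $S/I$ has an $s$-linear resolution if $I$ is generated in degree $s$ and $\beta_{i,j}=0$ whenever $i\ge1$ and $j\ne s+i-1$; it has a linear resolution if it has an $s$-linear resolution for some $s\ge 1$. *)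

(* Defs.v *)
(* MathComp world, with multinomials for the polynomial ring and boolp for
   classical reasoning. *)
From HB Require Import structures.
From mathcomp Require Import all_boot all_algebra boolp.
From mathcomp.multinomials Require Import mpoly.

Set Implicit Arguments.
Unset Strict Implicit.
Unset Printing Implicit Defensive.

Import GRing.Theory.
Local Open Scope ring_scope.
Local Open Scope quotient_scope.

(** * Ideals and quotient rings *)

(* Ideals are Prop-valued and may be improper, unlike the decidable proper
   [idealr] of ring_quotient.v; the quotient may therefore be the zero ring. *)
Record ideal (R : comPzRingType) := Ideal {
  ideal_mem :> R -> Prop;
  ideal_mem0 : ideal_mem 0;
  ideal_memD : forall x y, ideal_mem x -> ideal_mem y -> ideal_mem (x + y);
  ideal_memMl : forall a x, ideal_mem x -> ideal_mem (a * x) }.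

Section GeneratedIdeal.
Variables (R : comPzRingType) (G : R -> Prop).

Definition span_mem (p : R) : Prop :=
  exists (r : nat) (c g : 'I_r -> R),
    (forall i, G (g i)) /\ p = \sum_(i < r) c i * g i.

Lemma span_mem0 : span_mem 0.
Proof.
by exists 0%N, (fun=> 0), (fun=> 0); split; [case | rewrite big_ord0].
Qed.

Lemma span_memD x y : span_mem x -> span_mem y -> span_mem (x + y).
Proof.
move=> [r [c [g [Gg ->]]]] [r' [c' [g' [Gg' ->]]]].
pose glue (f : 'I_r -> R) (f' : 'I_r' -> R) (i : 'I_(r + r')) :=
  match split i with inl j => f j | inr j => f' j end.
exists (r + r')%N, (glue c c'), (glue g g'); split.
  by move=> i; rewrite /glue; case: (split i).
rewrite big_split_ord /=; congr (_ + _); apply: eq_bigr => i _.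
  by rewrite /glue -[lshift _ _]/(unsplit (inl i)) unsplitK.
by rewrite /glue -[rshift _ _]/(unsplit (inr i)) unsplitK.
Qed.

Lemma span_memMl a x : span_mem x -> span_mem (a * x).
Proof.
move=> [r [c [g [Gg ->]]]]; exists r, (fun i => a * c i), g; split=> //.
by rewrite mulr_sumr; apply: eq_bigr => i _; rewrite mulrA.
Qed.

Definition ideal_span : ideal R := Ideal span_mem0 span_memD span_memMl.

End GeneratedIdeal.

Section Quotient.
Variables (R : comPzRingType) (I : ideal R).

Lemma ideal_memN x : I x -> I (- x).
Proof. by rewrite -mulN1r; apply: ideal_memMl. Qed.

Lemma ideal_memMr x a : I x -> I (x * a).
Proof. by rewrite mulrC; apply: ideal_memMl. Qed.

Definition ideal_equiv (x y : R) : bool := `[< I (x - y) >].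

Lemma ideal_equiv_is_equiv : equiv_class_of ideal_equiv.
Proof.
split=> [x|x y|y x z]; rewrite /ideal_equiv.
- by rewrite subrr; apply/asboolP/ideal_mem0.
- by apply/asboolP/asboolP=> /ideal_memN; rewrite opprB.
- move=> /asboolP Ixy /asboolP Iyz; apply/asboolP.
  by rewrite -[x](addrNK y) -addrA; apply: ideal_memD.
Qed.

Canonical ideal_equiv_rel := EquivRelPack ideal_equiv_is_equiv.
Canonical ideal_equiv_encModRel := defaultEncModRel ideal_equiv.

Definition quotient := {eq_quot ideal_equiv}.

HB.instance Definition _ : EqQuotient R ideal_equiv quotient :=
  EqQuotient.on quotient.
HB.instance Definition _ := Choice.on quotient.

Lemma quotient_eqP x y : reflect (I (x - y)) (x == y %[mod quotient]).
Proof. by rewrite piE; apply: asboolP. Qed.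

Lemma quotient_eq x y : I (x - y) <-> \pi_quotient x = \pi_quotient y.
Proof. by split=> [/quotient_eqP/eqP|/eqP/quotient_eqP]. Qed.

Definition quotient_zero : quotient := lift_cst quotient 0.
Definition quotient_add := lift_op2 quotient +%R.
Definition quotient_opp := lift_op1 quotient -%R.
Definition quotient_one : quotient := lift_cst quotient 1.
Definition quotient_mul := lift_op2 quotient *%R.

Canonical pi_quotient_zero := PiConst quotient_zero.
Canonical pi_quotient_one := PiConst quotient_one.

Lemma pi_oppq : {morph \pi_quotient : x / - x >-> quotient_opp x}.
Proof.
move=> x; unlock quotient_opp; apply/quotient_eq.
by rewrite -opprD; apply/ideal_memN/quotient_eq; rewrite reprK.
Qed.
Canonical pi_quotient_opp := PiMorph1 pi_oppq.

Lemma pi_addq : {morph \pi_quotient : x y / x + y >-> quotient_add x y}.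
Proof.
move=> x y; unlock quotient_add; apply/quotient_eq.
by rewrite opprD addrACA; apply/ideal_memD; apply/quotient_eq; rewrite reprK.
Qed.
Canonical pi_quotient_add := PiMorph2 pi_addq.

Lemma pi_mulq : {morph \pi_quotient : x y / x * y >-> quotient_mul x y}.
Proof.
move=> x y; unlock quotient_mul; apply/quotient_eq.
rewrite -[x * y](addrNK (x * repr (\pi_quotient y))) -addrA.
rewrite -mulrBr -mulrBl; apply: ideal_memD.
  by apply: ideal_memMl; apply/quotient_eq; rewrite reprK.
by apply: ideal_memMr; apply/quotient_eq; rewrite reprK.
Qed.
Canonical pi_quotient_mul := PiMorph2 pi_mulq.

Lemma quotient_addA : associative quotient_add.
Proof. by move=> x y z; rewrite -[x]reprK -[y]reprK -[z]reprK !piE addrA. Qed.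

Lemma quotient_addC : commutative quotient_add.
Proof. by move=> x y; rewrite -[x]reprK -[y]reprK !piE addrC. Qed.

Lemma quotient_add0 : left_id quotient_zero quotient_add.
Proof. by move=> x; rewrite -[x]reprK !piE add0r. Qed.

Lemma quotient_addN : left_inverse quotient_zero quotient_opp quotient_add.
Proof. by move=> x; rewrite -[x]reprK !piE addNr. Qed.

HB.instance Definition _ := GRing.isZmodule.Build quotient
  quotient_addA quotient_addC quotient_add0 quotient_addN.

Lemma quotient_mulA : associative quotient_mul.
Proof. by move=> x y z; rewrite -[x]reprK -[y]reprK -[z]reprK !piE mulrA. Qed.

Lemma quotient_mulC : commutative quotient_mul.
Proof. by move=> x y; rewrite -[x]reprK -[y]reprK !piE mulrC. Qed.

Lemma quotient_mul1 : left_id quotient_one quotient_mul.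
Proof. by move=> x; rewrite -[x]reprK !piE mul1r. Qed.

Lemma quotient_mulDl : left_distributive quotient_mul +%R.
Proof.
move=> x y z; rewrite -[x]reprK -[y]reprK -[z]reprK.
by rewrite -[LHS]/(quotient_mul (quotient_add _ _) _)
  -[RHS]/(quotient_add _ _) !piE mulrDl.
Qed.

HB.instance Definition _ := GRing.Zmodule_isComPzRing.Build quotient
  quotient_mulA quotient_mulC quotient_mul1 quotient_mulDl.

Definition to_quotient (x : R) : quotient := \pi_quotient x.

Lemma to_quotient_is_zmod_morphism : zmod_morphism to_quotient.
Proof. by move=> x y; rewrite /to_quotient pi_addq pi_oppq. Qed.

Lemma to_quotient_is_monoid_morphism : monoid_morphism to_quotient.
Proof. by split; [rewrite /to_quotient piE | exact: pi_mulq]. Qed.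

HB.instance Definition _ := GRing.isZmodMorphism.Build R quotient
  to_quotient to_quotient_is_zmod_morphism.
HB.instance Definition _ := GRing.isMonoidMorphism.Build R quotient
  to_quotient to_quotient_is_monoid_morphism.

Lemma to_quotient_eq0 x : to_quotient x = 0 <-> I x.
Proof.
by rewrite -(rmorph0 to_quotient) -{2}[x]subr0; split=> /quotient_eq.
Qed.

Lemma to_quotient_surj (q : quotient) : exists x, to_quotient x = q.
Proof. by exists (repr q); rewrite /to_quotient reprK. Qed.

End Quotient.

(** * Dimension, depth and Cohen-Macaulayness *)

Section DimensionDepth.
Variable R : comPzRingType.

Definition prime_ideal (P : ideal R) : Prop :=
  ~ P 1 /\ forall x y, P (x * y) -> P x \/ P y.

Definition strictly_included (P Q : ideal R) : Prop :=
  (forall x, P x -> Q x) /\ exists x, Q x /\ ~ P x.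

(* c 0 < c 1 < ... < c d; the values of c beyond d are irrelevant. *)
Definition prime_chain (d : nat) (c : nat -> ideal R) : Prop :=
  (forall i, (i <= d)%N -> prime_ideal (c i)) /\
  (forall i, (i < d)%N -> strictly_included (c i) (c i.+1)).

Definition has_krull_dim (d : nat) : Prop :=
  (exists c, prime_chain d c) /\
  (forall d' c, prime_chain d' c -> (d' <= d)%N).

Definition regular_sequence (s : seq R) : Prop :=
  ~ ideal_span (fun y => y \in s) 1 /\
  forall i, (i < size s)%N -> forall x,
    ideal_span (fun y => y \in take i s) (s`_i * x) ->
    ideal_span (fun y => y \in take i s) x.

Definition has_depth (m : ideal R) (d : nat) : Prop :=
  (exists s, [/\ regular_sequence s, forall y, y \in s -> m y & size s = d]) /\
  (forall s, regular_sequence s -> (forall y, y \in s -> m y) ->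
    (size s <= d)%N).

End DimensionDepth.

Section GradedQuotients.
Variables (F : fieldType) (n : nat).
Local Notation S := {mpoly F[n]}.

Definition irrelevant_ideal (I : ideal S) : ideal (quotient I) :=
  ideal_span (fun q => exists v : 'I_n, q = to_quotient I 'X_v).

(* For a homogeneous ideal I, the standard graded algebra S/I is
   Cohen-Macaulay when its depth, taken with respect to the irrelevant maximal
   ideal, equals its Krull dimension. *)
Definition cohen_macaulay (I : ideal S) : Prop :=
  exists d, has_krull_dim (quotient I) d /\ has_depth (irrelevant_ideal I) d.

(** * Graded Betti numbers and linear resolutions *)

(* Graded free resolution ... -> P_1 -> P_0 -> S/I -> 0 by modules of finite
   rank.  P_i has basis indexed by 'I_(rank i), the a-th basis element having
   degree [deg i a]; elements of P_i are row vectors and maps act by right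
   multiplication.  The augmentation P_0 -> S/I is [aug] followed by S -> S/I.
   The homogeneity conditions hold trivially for zero entries. *)
Record graded_resolution (I : ideal S) := GradedResolution {
  rank : nat -> nat;
  deg : forall i, 'I_(rank i) -> nat;
  diff : forall i, 'M[S]_(rank i.+1, rank i);
  aug : 'cV[S]_(rank 0);
  diff_homog : forall i a b m,
    m \in msupp (diff i a b) -> (mdeg m + deg b = deg a)%N;
  aug_homog : forall a, aug a 0 \is (deg a).-homog;
  aug_surj : forall q : quotient I,
    exists v : 'rV[S]_(rank 0), to_quotient I ((v *m aug) 0 0) = q;
  aug_exact : forall v : 'rV[S]_(rank 0),
    to_quotient I ((v *m aug) 0 0) = 0 <-> exists w, v = w *m diff 0;
  diff_exact : forall i (v : 'rV[S]_(rank i.+1)),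
    v *m diff i = 0 <-> exists w, v = w *m diff i.+1 }.

(* Matrix of the differential of P tensored over S with F = S/(x_v : v):
   only constant terms survive. *)
Definition residue_diff (I : ideal S) (P : graded_resolution I) i :
    'M[F]_(rank P i.+1, rank P i) :=
  map_mx (mcoeff 0%MM) (diff P i).

(* Projection of P_i (x) F onto its component of degree j. *)
Definition degree_part (I : ideal S) (P : graded_resolution I) i j :
    'M[F]_(rank P i) :=
  diag_mx (\row_a (@deg I P i a == j)%:R).

Definition residue_cycles (I : ideal S) (P : graded_resolution I) i :
    'M[F]_(rank P i) :=
  if i is i'.+1 then kermx (residue_diff P i') else 1%:M.

(* dim_F H_i(P (x) F)_j, as dim (cycles) - dim (boundaries). *)
Definition tor_dim (I : ideal S) (P : graded_resolution I) (i j : nat) : nat :=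
  (\rank (residue_cycles P i :&: degree_part P i j)%MS
   - \rank (degree_part P i.+1 j *m residue_diff P i))%N.

(* beta_{i,j}(S/I) = b.  Tor is computed by any graded free resolution, and
   the result does not depend on which one. *)
Definition graded_betti (I : ideal S) (i j b : nat) : Prop :=
  exists P : graded_resolution I, tor_dim P i j = b.

Definition generated_in_degree (s : nat) (I : ideal S) : Prop :=
  forall p, I p -> ideal_span (fun f => I f /\ f \is s.-homog) p.

Definition has_s_linear_resolution (s : nat) (I : ideal S) : Prop :=
  generated_in_degree s I /\
  forall i j, (1 <= i)%N -> j <> (s + i - 1)%N -> graded_betti I i j 0.

Definition has_linear_resolution (I : ideal S) : Prop :=
  exists s, (1 <= s)%N /\ has_s_linear_resolution s I.

End GradedQuotients.

(** * Simplicial complexes on 'I_n *)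

Record complex (n : nat) := Complex {
  faces :> {set {set 'I_n}};
  faces_closed : forall A B : {set 'I_n},
    A \in faces -> B \subset A -> B \in faces }.

Section Complexes.
Variable n : nat.

Lemma alexander_dual_closed (D : complex n) (A B : {set 'I_n}) :
  A \in [set A : {set 'I_n} | ~: A \notin D] -> B \subset A ->
  B \in [set A : {set 'I_n} | ~: A \notin D].
Proof.
rewrite !inE => nDA sBA; apply: contra nDA => DB.
by apply: (faces_closed DB); rewrite setCS.
Qed.

Definition alexander_dual (D : complex n) : complex n :=
  Complex (@alexander_dual_closed D).

Definition stanley_reisner_ideal (F : fieldType) (D : complex n) :
    ideal {mpoly F[n]} :=
  ideal_span (fun p => exists A : {set 'I_n},
    A \notin D /\ p = \prod_(v in A) 'X_v).

End Complexes.

(** * Total cut complexes *)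

Record simple_graph (n : nat) := SimpleGraph {
  adj :> rel 'I_n;
  adj_sym : forall x y, adj x y = adj y x;
  adj_irr : forall x, adj x x = false }.

Definition edgeless_graph (n : nat) : simple_graph n :=
  @SimpleGraph n (fun _ _ => false) (fun _ _ => erefl) (fun _ => erefl).

Section TotalCut.
Variables (n : nat) (G : simple_graph n) (k : nat).

Definition independent (M : {set 'I_n}) : bool :=
  [forall x in M, forall y in M, ~~ G x y].

Definition total_cut_faces : {set {set 'I_n}} :=
  [set A : {set 'I_n} | [exists M : {set 'I_n},
    [&& independent M, #|M| == k & A \subset ~: M]]].

Lemma total_cut_closed (A B : {set 'I_n}) :
  A \in total_cut_faces -> B \subset A -> B \in total_cut_faces.
Proof.
rewrite !inE => /existsP[M /and3P[iM cM sAM]] sBA; apply/existsP; exists M.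
by rewrite iM cM (subset_trans sBA sAM).
Qed.

Definition total_cut_complex : complex n := Complex total_cut_closed.

End TotalCut.

(* Main.v *)
(* Both rings are quotients S/I by a squarefree Veronese ideal I = I_{n,d},
   1 <= d <= n, spanned by the monomials whose support has at least d elements:
   d = n - k + 1 for the total cut complex and d = k for its dual.

   Linear resolution: I_{n,d} = A + x B with A = I_{n-1,d} and B = I_{n-1,d-1},
   x the last variable, and x b in A forces b in A; so the mapping cone of
   (x, -incl) : A(-1) -> A + B(-1) turns linear resolutions of A and B into one
   of I_{n,d}.

   Dimension and depth are at most d - 1: counting monomials, any d elements of
   S/I are algebraically dependent, and the lowest term of the relation, for the
   lexicographic order, obstructs both regular sequences and chains of primes
   of length d.

   Depth is at least d - 1, over any field: the complete symmetric polynomials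
   h_a, ..., h_{a+d-2} form a regular sequence on S/I_{n,d} for every a >= 1.
   Writing x for the last variable and h' for the polynomials in the others,
   h_{j+1} = h'_{j+1} + x h_j, so h_a, ..., h_{a+d-2} generates the same
   successive ideals as h_a, h'_{a+1}, ..., h'_{a+d-2}, where h_a is monic in x.
   One inducts on n through the filtration of S/I_{n,d} with factors
   S/(I_{n-1,d} + (x)) and S/I_{n-1,d-1}. *)
Require Import Defs.
From HB Require Import structures.
From mathcomp Require Import all_boot all_algebra boolp.
From mathcomp.multinomials Require Import mpoly.

Set Implicit Arguments.
Unset Strict Implicit.
Unset Printing Implicit Defensive.

Import GRing.Theory.
Local Open Scope ring_scope.

(** * Weakly regular sequences *)

Section IdealBasics.
Variable R : comPzRingType.
Implicit Types K L M : ideal R.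

Lemma ideal_memB K x y : K x -> K y -> K (x - y).
Proof. by move=> Kx Ky; apply: ideal_memD => //; apply: ideal_memN. Qed.

Lemma ideal_mem_sum K (T : Type) (r : seq T) (P : pred T) (f : T -> R) :
  (forall i, P i -> K (f i)) -> K (\sum_(i <- r | P i) f i).
Proof.
by move=> Kf; elim/big_ind: _ => //; [exact: ideal_mem0 | exact: ideal_memD].
Qed.

Lemma ideal_span_gen (G : R -> Prop) x : G x -> ideal_span G x.
Proof.
move=> Gx; exists 1%N, (fun=> 1), (fun=> x).
by rewrite big_ord1 mul1r.
Qed.

Lemma ideal_span_min (G : R -> Prop) K :
  (forall x, G x -> K x) -> forall x, ideal_span G x -> K x.
Proof.
move=> GK x [r [c [g [Gg ->]]]]; apply: ideal_mem_sum => i _.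
by apply/ideal_memMl/GK.
Qed.

Definition idealT : ideal R := @Ideal R (fun=> True) I (fun _ _ _ _ => I)
  (fun _ _ _ => I).

Lemma ideal_add_mul_mem0 K L y : exists l k, [/\ L l, K k & 0 = y * l + k].
Proof.
by exists 0, 0; split; [exact: ideal_mem0 .. | rewrite mulr0 addr0].
Qed.

Lemma ideal_add_mul_memD K L y u v :
  (exists l k, [/\ L l, K k & u = y * l + k]) ->
  (exists l k, [/\ L l, K k & v = y * l + k]) ->
  exists l k, [/\ L l, K k & u + v = y * l + k].
Proof.
move=> [l [k [Ll Kk ->]]] [l' [k' [Ll' Kk' ->]]].
exists (l + l'), (k + k'); split; [exact: ideal_memD .. |].
by rewrite mulrDr addrACA.
Qed.

Lemma ideal_add_mul_memMl K L y a u :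
  (exists l k, [/\ L l, K k & u = y * l + k]) ->
  exists l k, [/\ L l, K k & a * u = y * l + k].
Proof.
move=> [l [k [Ll Kk ->]]]; exists (a * l), (a * k).
by split; [exact: ideal_memMl .. | rewrite mulrDr mulrCA].
Qed.

(** This is [K + y L]; for [K] inside [L], the quotient of [L] by it is the cokernel of
    multiplication by [y] on [L / K]. *)
Definition ideal_add_mul K L y : ideal R :=
  Ideal (@ideal_add_mul_mem0 K L y) (@ideal_add_mul_memD K L y)
    (@ideal_add_mul_memMl K L y).

Lemma ideal_add_mulr K L y k : K k -> ideal_add_mul K L y k.
Proof.
by exists 0, k; split; rewrite ?mulr0 ?add0r //; apply: ideal_mem0.
Qed.

Lemma ideal_add_mull K L y l : L l -> ideal_add_mul K L y (y * l).
Proof. by exists l, 0; split; rewrite ?addr0 //; apply: ideal_mem0. Qed.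

(* The sequence [s] is weakly regular on the module [L / K]. *)
Fixpoint weakly_regular K L (s : seq R) : Prop :=
  if s is y :: s' then
    (forall x, L x -> K (y * x) -> K x) /\
    weakly_regular (ideal_add_mul K L y) L s'
  else True.

End IdealBasics.

(* [g] induces an isomorphism from [L / K] onto [L' / K'] intertwining
   multiplication by [u i] and by [u' i]. *)
Lemma weakly_regular_iso (R R' : comPzRingType) (g : {additive R -> R'})
    (T : Type) (u : T -> R) (u' : T -> R') (s : seq T)
    (K L : ideal R) (K' L' : ideal R') :
  (forall x, L x -> L' (g x)) ->
  (forall z, L' z -> exists x k, [/\ L x, K' k & z = g x + k]) ->
  (forall x, L x -> K x <-> K' (g x)) ->
  (forall k, K k -> L k) ->
  (forall i x, L x -> K' (g (u i * x) - u' i * g x)) ->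
  weakly_regular K L (map u s) -> weakly_regular K' L' (map u' s).
Proof.
move=> gL Lg + + + ; elim: s K K' Lg => //= i s IHs K K' Lg gK KL gu [reg regs].
split=> [z /Lg[x [k [Lx Kk ->]]] Kux|].
  apply: ideal_memD => //; apply/gK/reg/gK => //; first exact: ideal_memMl.
  rewrite -[g _](subrK (u' i * g x)); apply: ideal_memD; first exact: gu.
  rewrite -[_ * _](addrK (u' i * k)) -mulrDr; apply: ideal_memB => //.
  exact: ideal_memMl.
apply: (IHs _ _ _ _ _ _ regs).
- move=> z /Lg[x [k [Lx Kk ->]]]; exists x, k; split=> //.
  exact: ideal_add_mulr.
- move=> x Lx.
  split=> [[l [k [Ll Kk ->]]]|[_ [k [/Lg[l [k' [Ll Kk' ->]]] Kk]]]].
    rewrite raddfD /= -[g (_ * _)](subrK (u' i * g l)) -addrA addrC -addrA.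
    apply: (@ideal_memD _ (ideal_add_mul _ _ _)).
      exact/ideal_add_mull/gL.
    apply: ideal_add_mulr; apply: ideal_memD; last exact: gu.
    by apply/gK => //; apply: KL.
  move=> gx; exists l, (x - u i * l); rewrite addrCA subrr addr0; split=> //.
  apply/gK; first by apply: ideal_memB => //; apply: ideal_memMl.
  have -> : g (x - u i * l) = u' i * k' + k - (g (u i * l) - u' i * g l).
    rewrite raddfB gx mulrDr opprB addrA -(addrA (u' i * g l)); congr (_ - _).
    exact: addrC.
  by apply: ideal_memB (gu _ _ Ll); apply: ideal_memD => //; apply: ideal_memMl.
- move=> _ [l [k [Ll Kk ->]]]; apply: ideal_memD; last exact: KL.
  exact: ideal_memMl.
- by move=> j x Lx; apply/ideal_add_mulr/gu.
Qed.

Section WeaklyRegular.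
Variable R : comPzRingType.
Implicit Types K L M : ideal R.

Lemma eq_weakly_regular K K' L s :
  (forall x, K x <-> K' x) -> (forall x, K x -> L x) ->
  weakly_regular K L s -> weakly_regular K' L s.
Proof.
move=> eqK KL; rewrite -[s]map_id.
apply: (@weakly_regular_iso _ _ (idfun : {additive R -> R})) => //=.
  by move=> z Lz; exists z, 0; rewrite addr0; split=> //; apply: ideal_mem0.
by move=> i x _; rewrite subrr; apply: ideal_mem0.
Qed.

(** Regularity passes from the ends of [0 -> L/K -> M/K -> M/L -> 0] to the middle. The sequence
    stays exact after dividing by [y]: if [y l + k] lies in [L], regularity on [M / L] puts [l] in
    [L], so [L] meets [K + y M] in [K + y L]. *)
Lemma weakly_regular_filtration K L M s :
  (forall x, K x -> L x) -> (forall x, L x -> M x) ->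
  weakly_regular K L s -> weakly_regular L M s -> weakly_regular K M s.
Proof.
elim: s K L => //= y s IHs K L KL LM [regK regKs] [regL regLs].
split=> [x Mx Kyx|]; first by apply: (regK) => //; apply/regL/KL.
apply: IHs regLs.
- move=> _ [l [k [Ml Kk ->]]]; exists l, k; split=> //; exact: KL.
- move=> _ [l [k [Ml Lk ->]]]; apply: ideal_memD; last exact: LM.
  exact: ideal_memMl.
rewrite -[s]map_id; move: regKs; rewrite -[s in X in X -> _]map_id.
apply: (@weakly_regular_iso _ _ (idfun : {additive R -> R})) => //=.
- by move=> x Lx; apply: ideal_add_mulr.
- move=> _ [l [k [Ml Lk ->]]]; exists k, (y * l); rewrite addrC; split=> //.
  exact: ideal_add_mull.
- move=> x Lx; split=> [[l [k [Ll Kk ->]]]|[l [k [Ml Kk xE]]]].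
    by exists l, k; split=> //; apply: LM.
  exists l, k; split=> //; apply: regL => //.
  by rewrite -[y * l](addrK k) -xE; apply: ideal_memB => //; apply: KL.
- move=> _ [l [k [Ll Kk ->]]]; apply: ideal_memD (KL _ Kk).
  exact: ideal_memMl.
- by move=> i x _; rewrite subrr; exact: ideal_add_mul_mem0.
Qed.

(* Once [t a] is killed, [t j] and [t' j] agree up to the previous terms. *)
Lemma weakly_regular_perturb K L (t t' : nat -> R) x a r :
  (forall x, K x -> L x) ->
  (forall j, t j.+1 = t' j.+1 + x * t j) ->
  (forall l, L l -> K (t a * l)) ->
  weakly_regular K L (map t' (iota a.+1 r)) ->
  weakly_regular K L (map t (iota a.+1 r)).
Proof.
move=> + tS; elim: r a K => //= r IHr a K KL Kta [reg regs].
have tt' l : L l -> K (t a.+1 * l - t' a.+1 * l).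
  move=> Ll; rewrite -mulrBl tS addrC addrA addNr add0r -mulrA.
  exact/ideal_memMl/Kta.
split=> [l Ll Ktl|].
  by apply: reg => //; rewrite -[_ * _](subKr (t a.+1 * l));
    apply: ideal_memB (tt' _ Ll).
apply: IHr.
- move=> _ [l [k [Ll Kk ->]]]; apply: ideal_memD; last exact: KL.
  exact: ideal_memMl.
- by move=> l Ll; apply: ideal_add_mull.
apply: eq_weakly_regular regs.
  move=> z; split=> [] [l [k [Ll Kk ->]]].
    exists l, (k - (t a.+1 * l - t' a.+1 * l)); split=> //.
      by apply: ideal_memB => //; apply: tt'.
    by rewrite opprB addrA addrC addrA subrK addrC.
  exists l, (k + (t a.+1 * l - t' a.+1 * l)); split=> //.
    by apply: ideal_memD => //; apply: tt'.
  by rewrite addrA addrC addrA subrK.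
move=> _ [l [k [Ll Kk ->]]]; apply: ideal_memD; last exact: KL.
exact: ideal_memMl.
Qed.

(** Carrying the elements already divided out in [s0] makes the induction on [s] match the prefixes
    used by [regular_sequence]. *)
Lemma weakly_regular_span s0 s :
  weakly_regular (ideal_span (fun y => y \in s0)) (idealT R) s ->
  forall i, (i < size s)%N -> forall x,
    ideal_span (fun y => y \in s0 ++ take i s) (s`_i * x) ->
    ideal_span (fun y => y \in s0 ++ take i s) x.
Proof.
elim: s s0 => //= y s IHs s0 [reg regs] [|i] ltis x /=.
  by rewrite cats0; apply: reg.
rewrite -cat_rcons; apply: IHs => //; apply: eq_weakly_regular regs => // z.
split=> [[l [k [_ Kk ->]]]|].
  apply: ideal_memD.
    by apply/ideal_memMr/ideal_span_gen; rewrite mem_rcons mem_head.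
  apply: ideal_span_min Kk => u us; apply: ideal_span_gen.
  by rewrite mem_rcons in_cons us orbT.
apply: ideal_span_min => u; rewrite mem_rcons in_cons => /predU1P[->|us].
  have := @ideal_add_mull _ (ideal_span (fun y => y \in s0)) (idealT R) y 1 I.
  by rewrite mulr1.
exact/ideal_add_mulr/ideal_span_gen.
Qed.

End WeaklyRegular.

(** * Adjoining one variable: from [R] to [R[X]] *)

Section PolynomialExtension.
Variable R : comNzRingType.
Implicit Types (K : ideal R) (p q f : {poly R}).

Section PolyIdeal.
Variables K0 K : ideal R.

(** Two special cases matter: [K0 = idealT R] gives the extension [K[X]], and [K = idealT R] gives
    [K0 + (X)]. *)
Definition poly_ideal_mem p : Prop := K0 p`_0 /\ forall i, K p`_i.

Lemma poly_ideal_mem0 : poly_ideal_mem 0.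
Proof. by split=> [|i]; rewrite coef0; apply: ideal_mem0. Qed.

Lemma poly_ideal_memD p q :
  poly_ideal_mem p -> poly_ideal_mem q -> poly_ideal_mem (p + q).
Proof.
by move=> [p0 Kp] [q0 Kq]; split=> [|i]; rewrite coefD; apply: ideal_memD.
Qed.

Lemma poly_ideal_memMl q p : poly_ideal_mem p -> poly_ideal_mem (q * p).
Proof.
move=> [p0 Kp]; split=> [|i].
  by rewrite coefM big_ord1; apply: ideal_memMl.
by rewrite coefM; apply: ideal_mem_sum => j _; apply: ideal_memMl.
Qed.

Definition poly_ideal : ideal {poly R} :=
  Ideal poly_ideal_mem0 poly_ideal_memD poly_ideal_memMl.

End PolyIdeal.

(** Descending induction on the index [i]: as [f] is monic, the coefficient of [f * p] at
    [i + deg f] is the [i]-th coefficient of [p] plus multiples of coefficients of [p] of higher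
    index. *)
Lemma monic_regular_mod K f p :
  f \is monic -> poly_ideal (idealT R) K (f * p) -> poly_ideal (idealT R) K p.
Proof.
move=> f_monic [_ Kfp]; split=> // i.
have [k] := ubnP (size p - i); elim: k i => // k IHk i lek.
have [/(nth_default 0)->|lti] := leqP (size p) i; first exact: ideal_mem0.
have fE : ((size f).-1 < (i + (size f).-1).+1)%N by rewrite ltnS leq_addl.
have := Kfp (i + (size f).-1)%N; rewrite coefM (bigD1 (Ordinal fE)) //=.
rewrite addnK -lead_coefE (monicP f_monic) mul1r => Ksum.
rewrite -[p`_i](addrK (\sum_(j < (i + (size f).-1).+1 | j != Ordinal fE)
  f`_j * p`_(i + (size f).-1 - j))).
apply: ideal_memB => //; apply: ideal_mem_sum => j.
rewrite -val_eqE /= neq_ltn => /orP[ltj|gtj].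
  apply: ideal_memMl; apply: IHk.
  have lt_i : (i < i + (size f).-1 - j)%N.
    have : (i + 0 < i + ((size f).-1 - j))%N by rewrite ltn_add2l subn_gt0.
    by rewrite addn0 addnBA // ltnW.
  by rewrite ltnS in lek; apply: leq_trans lek; rewrite ltn_sub2l.
rewrite [f`_j]nth_default ?mul0r; first exact: ideal_mem0.
by rewrite (leq_trans _ gtj) // -ltnS; case: (size f).
Qed.

Lemma poly_ideal_add_mul K y p :
  poly_ideal (idealT R) (ideal_add_mul K (idealT R) y) p <->
  ideal_add_mul (poly_ideal (idealT R) K) (idealT {poly R}) y%:P p.
Proof.
split=> [[_ Kp]|[q [r [_ [_ Kr] ->]]]]; last first.
  split=> // i; rewrite coefD coefCM; exists q`_i, r`_i; split=> //.
have /choice[l lP] i : exists l, K (p`_i - y * l).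
  by have [l [k [_ Kk ->]]] := Kp i; exists l; rewrite addrAC subrr add0r.
exists (\poly_(i < size p) l i), (p - y%:P * \poly_(i < size p) l i).
split=> //; last by rewrite addrCA subrr addr0.
split=> // i; rewrite coefB coefCM coef_poly; case: ltnP => // lei.
by rewrite nth_default // mulr0 subr0; apply: ideal_mem0.
Qed.

(** Given [y u = f c + q] with [q] in [K[X]], regularity of [f] modulo [K + (y)] gives
    [c = y c' + q']. Then [y (u - f c')] lies in [K[X]], hence so does [u - f c'], and [u] lies in
    [K[X] + (f)]. *)
Lemma weakly_regular_monic K s f :
  f \is monic -> weakly_regular K (idealT R) s ->
  weakly_regular
    (ideal_add_mul (poly_ideal (idealT R) K) (idealT {poly R}) f)
    (idealT {poly R}) (map polyC s).
Proof.
move=> f_monic; elim: s K => //= y s IHs K [reg regs]; split.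
  move=> u _ [c [q [_ Kq yuE]]].
  have /poly_ideal_add_mul[c' [q' [_ Kq' cE]]] :
      poly_ideal (idealT R) (ideal_add_mul K (idealT R) y) c.
    apply: (@monic_regular_mod _ f) => //; apply/poly_ideal_add_mul.
    exists u, (- q); split=> //; first exact: ideal_memN.
    by rewrite yuE addrK.
  exists c', (u - f * c'); split=> //; last by rewrite addrCA subrr addr0.
  have [_ Kyu] : poly_ideal (idealT R) K (y%:P * (u - f * c')).
    rewrite mulrBr yuE cE mulrDr [y%:P * (f * _)]mulrCA addrAC.
    rewrite [_ + f * q']addrC addrK; apply: ideal_memD => //.
    exact: ideal_memMl.
  by split=> // i; apply: reg => //; rewrite -coefCM.
apply: eq_weakly_regular (IHs _ regs) => // z; split.
  move=> [l [k [_ /poly_ideal_add_mul[l' [k' [_ Kk' ->]]] ->]]].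
  exists l', (f * l + k'); split=> //; last by rewrite addrCA.
  by exists l, k'.
move=> [l [_ [_ [l' [k' [_ Kk' ->]]] ->]]].
exists l', (y%:P * l + k'); split=> //; last by rewrite addrCA.
by apply/poly_ideal_add_mul; exists l, k'.
Qed.

(* If [h] lists the complete symmetric polynomials in some variables, then
   [hpoly h] lists those in these variables and ['X]. *)
Fixpoint hpoly (h : nat -> R) (j : nat) : {poly R} :=
  if j is j'.+1 then (h j)%:P + 'X * hpoly h j' else 1.

Lemma size_hpoly h j : size (hpoly h j) = j.+1.
Proof.
elim: j => [|j IHj] /=; first by rewrite size_poly1.
rewrite addrC mulrC size_polyDl size_mulX -?size_poly_eq0 ?IHj //.
by rewrite (leq_ltn_trans (size_polyC_leq1 _)).
Qed.

Lemma hpoly_monic h j : hpoly h j \is monic.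
Proof.
elim: j => [|j IHj]; first exact: monic1.
rewrite /= addrC monicE lead_coefDl.
  by rewrite mulrC lead_coefMX (monicP IHj).
by rewrite mulrC size_mulX -?size_poly_eq0 ?size_hpoly //
  (leq_ltn_trans (size_polyC_leq1 _)).
Qed.

Lemma coef0_hpoly h j : h 0%N = 1 -> (hpoly h j)`_0 = h j.
Proof.
case: j => [|j] /= h0; first by rewrite coef1 h0.
by rewrite coefD coefC coefXM addr0.
Qed.

Section Step.
Variables (n : nat) (K : nat -> ideal R) (h : nat -> R).
Hypothesis h0 : h 0%N = 1.
Hypothesis K_anti : forall r x, K r.+1 x -> K r x.
Hypothesis KnS : forall x, K n x -> K n.+1 x.
Hypothesis h_regular : forall r a, (r <= n)%N ->
  weakly_regular (K r) (idealT R) (map h (iota a.+1 r)).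

(** With [K r] the ideal I_{n,r+1}, this is I_{n+1,r+1} read in powers of [X]: a positive power of
    [X] supplies one element of the support, so those coefficients need only lie in I_{n,r}, the
    whole ring when [r = 0]. *)
Definition hpoly_ideal (r : nat) : ideal {poly R} :=
  poly_ideal (K r) (if r is r'.+1 then K r' else idealT R).

Let hpoly_regular_full r a : (r <= n)%N ->
  weakly_regular (poly_ideal (idealT R) (K r)) (idealT {poly R})
    (map (hpoly h) (iota a.+1 r.+1)).
Proof.
move=> le_rn; split=> [x _|]; first exact/monic_regular_mod/hpoly_monic.
apply: (@weakly_regular_perturb _ _ _ (hpoly h) (polyC \o h) 'X) => //.
  by move=> l Tl; apply: ideal_add_mull.
rewrite map_comp; apply: weakly_regular_monic; first exact: hpoly_monic.
exact: h_regular.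
Qed.

Lemma hpoly_regular r a : (r <= n.+1)%N ->
  weakly_regular (hpoly_ideal r) (idealT {poly R})
    (map (hpoly h) (iota a.+1 r)).
Proof.
(* At the top index, [K n] is contained in [K n.+1], so the ideal is just [K n] extended to
   polynomials and the full case applies directly. *)
case: r => // r; rewrite ltnS leq_eqVlt => /orP[/eqP->|lt_rn].
  apply: eq_weakly_regular (hpoly_regular_full _ _) => // p.
  by split=> [] [p0 Kp]; split=> //; apply/KnS/Kp.
apply: (@weakly_regular_filtration _ _ (poly_ideal (K r.+1) (idealT R))) => //.
- by move=> p [p0 _].
(* Lower factor: multiplication by ['X] identifies [R[X] / K_r[X]] with the polynomials whose
   constant term is in [K r.+1], modulo [hpoly_ideal r.+1]. *)
- apply: (@weakly_regular_iso _ _ ('X \*o idfun : {additive _ -> _}))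
    (hpoly_regular_full a (ltnW lt_rn)) => //=.
  + by move=> p _; split=> // ; rewrite coefXM /=; apply: ideal_mem0.
  + move=> z [z0 _]; elim/poly_ind: z z0 => [|p c _] z0.
      exists 0, 0; split; rewrite ?mulr0 ?addr0 //.
      exact: poly_ideal_mem0.
    exists p, c%:P; rewrite mulrC; split=> //.
    have Kc : K r.+1 c by move: z0; rewrite coefD coefMX coefC add0r.
    split=> [|i]; rewrite coefC //; case: (i == 0)%N; last exact: ideal_mem0.
    exact: K_anti.
  + move=> p _; split=> [[_ Kp]|[_ Kp]].
      split=> [|[|i]]; rewrite coefXM //=; exact: ideal_mem0.
    by split=> // i; have := Kp i.+1; rewrite coefXM.
  + by move=> i p _; rewrite mulrCA subrr; exact: poly_ideal_mem0.
(* Upper factor: setting [X = 0] leaves [R / K_{r+1}], on which [hpoly h j] acts as its constant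
   term [h j]. *)
apply: (@weakly_regular_iso _ _ (polyC : {additive _ -> _}))
  (h_regular a lt_rn) => //=.
- move=> z _; elim/poly_ind: z => [|p c _].
    by exists 0, 0; split; rewrite ?addr0 //; exact: poly_ideal_mem0.
  exists c, (p * 'X); rewrite addrC; split=> //; split=> //.
  by rewrite coefMX; apply: ideal_mem0.
- by move=> x _; split=> [Kx|[]]; [split|]; rewrite ?coefC.
- move=> i x _; split=> //.
  rewrite coefB coefM big_ord1 !coefC coef0_hpoly // subrr.
  exact: ideal_mem0.
Qed.

End Step.
End PolynomialExtension.

(** * A regular sequence modulo the Veronese ideal *)

Section VeroneseIdeal.
Variables (R : comNzRingType) (n : nat) (U : {set 'I_n}).
Implicit Types (m : 'X_{1..n}) (p q : {mpoly R[n]}).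

Definition msupp_card m : nat := #|[set i in U | m i != 0%N]|.

Lemma msupp_card_addr m m' : (msupp_card m <= msupp_card (m' + m)%MM)%N.
Proof.
apply/subset_leq_card/subsetP => i; rewrite !inE mnmDE addn_eq0 negb_and.
by case/andP => -> ->; rewrite orbT.
Qed.

Section Def.
Variable d : nat.

Definition veronese_mem p : Prop :=
  {in msupp p, forall m, (d <= msupp_card m)%N}.

Lemma veronese_mem0 : veronese_mem 0.
Proof. by move=> m; rewrite msupp0. Qed.

Lemma veronese_memD p q :
  veronese_mem p -> veronese_mem q -> veronese_mem (p + q).
Proof.
by move=> Vp Vq m /msuppD_le; rewrite mem_cat => /orP[/Vp|/Vq].
Qed.

Lemma veronese_memMl q p : veronese_mem p -> veronese_mem (q * p).
Proof.
move=> Vp m /msuppM_le/allpairsP[[m1 m2] /= [_ m2p ->]].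
exact: leq_trans (Vp _ m2p) (msupp_card_addr _ _).
Qed.

(* This is the ideal generated by the squarefree monomials of degree [d] in the
   variables of [U]. *)
Definition veronese : ideal {mpoly R[n]} :=
  Ideal veronese_mem0 veronese_memD veronese_memMl.

End Def.

Lemma veronese_anti d d' p : (d' <= d)%N -> veronese d p -> veronese d' p.
Proof. by move=> le_d'd Vp m /Vp; apply: leq_trans. Qed.

End VeroneseIdeal.
Arguments veronese {R n} U d.

Section LastVariable.
Variables (R : comNzRingType) (n : nat).

Lemma mpoly_last_comm :
  commr_rmorph (mwiden (n := n) (R := R)) ('X_ord_max : {mpoly R[n.+1]}).
Proof. by move=> p; apply: mulrC. Qed.

(* The isomorphism inverse to [muni]. *)
Definition mpoly_of_poly : {poly {mpoly R[n]}} -> {mpoly R[n.+1]} :=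
  horner_morph mpoly_last_comm.

HB.instance Definition _ := GRing.RMorphism.on mpoly_of_poly.

Definition mnm_restr (m : 'X_{1..n.+1}) : 'X_{1..n} :=
  [multinom m (widen_ord (leqnSn n) i) | i < n].

Lemma mnm_restrK (m : 'X_{1..n.+1}) :
  (mnmwiden (mnm_restr m) + U_(ord_max) *+ m ord_max)%MM = m.
Proof.
apply/mnmP => i; rewrite mnmDE mulmnE mnm1E.
case: (unliftP ord_max i) => [j ->|->].
  have -> : lift ord_max j = widen_ord (leqnSn n) j.
    by apply: val_inj; rewrite /= /bump leqNgt ltn_ord.
  rewrite mnmwiden_widen mnmE -val_eqE /=.
  by rewrite gtn_eqF ?ltn_ord // mul0n addn0.
by rewrite mnmwiden_ordmax eqxx mul1n.
Qed.

Lemma mnm_joinK (m : 'X_{1..n}) i :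
  let m' := (mnmwiden m + U_(ord_max) *+ i)%MM in
  mnm_restr m' = m /\ m' ord_max = i.
Proof.
split; last by rewrite mnmDE mnmwiden_ordmax mulmnE mnm1E eqxx mul1n.
apply/mnmP => j; rewrite mnmE mnmDE mnmwiden_widen mulmnE mnm1E -val_eqE /=.
by rewrite gtn_eqF ?ltn_ord // mul0n addn0.
Qed.

Lemma mpoly_of_poly_muni p : mpoly_of_poly (muni p) = p.
Proof.
rewrite muniE rmorph_sum /= [RHS]mpolyE; apply: eq_bigr => m _.
rewrite -mul_polyC rmorphM /= rmorphXn /= /mpoly_of_poly horner_morphX.
rewrite horner_morphC /= mwidenZ mwidenX mpolyXn -scalerAl -mpolyXD.
by rewrite -/(mnm_restr m) mnm_restrK.
Qed.

Lemma mcoeff_mwiden (c : {mpoly R[n]}) m :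
  (mwiden c)@_m = if m ord_max == 0%N then c@_(mnm_restr m) else 0.
Proof.
case: eqP => [m0|/eqP mN0].
  by rewrite -[m in LHS]mnm_restrK m0 mulm0n addm0 mwiden_mnmwiden.
rewrite (mwidenE (leqnn _)) raddf_sum big1 //= => m' _.
rewrite mcoeffZ mcoeffX; case: eqP => [mE|_]; last by rewrite mulr0.
by rewrite -mE mnmwiden_ordmax in mN0.
Qed.

Lemma mcoeff_mpoly_of_poly p m :
  (mpoly_of_poly p)@_m = (p`_(m ord_max))@_(mnm_restr m).
Proof.
elim/poly_ind: p m => [|p c IHp] m.
  by rewrite rmorph0 coef0 !mcoeff0.
rewrite rmorphD rmorphM /= /mpoly_of_poly horner_morphX horner_morphC.
rewrite -/(mpoly_of_poly p) coefD coefMX coefC !mcoeffD mcoeff_mwiden.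
have [m0|mN0] := eqVneq (m ord_max) 0%N.
  rewrite mcoeff0; congr (_ + _); apply/memN_msupp_eq0.
  rewrite (perm_mem (msuppMX _ _)); apply/mapP => [[m' _ mE]].
  by move: m0; rewrite mE mnmDE mnm1E eqxx.
rewrite mcoeff0 !addr0.
have mE : (U_(ord_max) + (m - U_(ord_max)))%MM = m.
  by rewrite addmC submK // lep1mP.
rewrite -{1}mE mcoeffMX IHp mnmBE mnm1E eqxx subn1; congr (_ @_ _).
apply/mnmP => i; rewrite !mnmE -val_eqE /=.
by rewrite gtn_eqF ?ltn_ord // subn0.
Qed.

Lemma msupp_card_restr (m : 'X_{1..n.+1}) :
  msupp_card setT m = (msupp_card setT (mnm_restr m) + (m ord_max != 0%N))%N.
Proof.
rewrite /msupp_card -!sum1_card !big_mkcond /= big_ord_recr /=.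
congr (_ + _)%N; last by rewrite inE in_setT; case: (m ord_max == 0%N).
by rewrite [RHS]big_mkcond; apply: eq_bigr => i _; rewrite !inE mnmE.
Qed.

End LastVariable.

Lemma mpoly_regular_sequence (R : comNzRingType) n :
  exists h : nat -> {mpoly R[n]}, [/\ h 0%N = 1, forall j, (h j.+1)@_0%MM = 0
    & forall r a, (r <= n)%N ->
      weakly_regular (veronese setT r.+1) (idealT _) (map h (iota a.+1 r))].
Proof.
elim: n => [|n [h [h0 hS h_reg]]].
  (* The complete symmetric polynomials in no variables: 1 in degree 0, and 0 afterwards. *)
  exists (fun j => (j == 0%N)%:R); split=> // [j|r a].
    by rewrite mcoeff0.
  by rewrite leqn0 => /eqP->.
exists (@mpoly_of_poly R n \o hpoly h); split=> /= [|j|r a le_rn].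
- by rewrite rmorph1.
- rewrite mcoeff_mpoly_of_poly mnm0E (_ : mnm_restr 0 = 0%MM).
    by rewrite -/(hpoly h j.+1) coef0_hpoly.
  by apply/mnmP => i; rewrite mnmE !mnm0E.
have K_anti k (p : {mpoly R[n]}) :
    veronese setT k.+2 p -> veronese setT k.+1 p :> Prop.
  exact: veronese_anti.
have KnS (p : {mpoly R[n]}) :
    veronese setT n.+1 p -> veronese setT n.+2 p :> Prop.
  (* No monomial in [n] variables has a support of [n + 1] elements, so [p] has no monomials at
     all. *)
  move=> Vp m /Vp; rewrite leqNgt ltnS.
  by rewrite (leq_trans (max_card _)) ?card_ord.
have h_poly_reg := hpoly_regular h0 K_anti KnS h_reg a le_rn.
rewrite map_comp.
apply: (@weakly_regular_iso _ _ (@mpoly_of_poly R n : {additive _ -> _}) _ id);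
  last by rewrite map_id; exact: h_poly_reg.
- by [].
- move=> z _; exists (muni z), 0; rewrite addr0 /= mpoly_of_poly_muni.
  by split=> //; exact: veronese_mem0.
- move=> p _; split=> [[Kp0 Kp] m|Kp].
    rewrite mcoeff_msupp mcoeff_mpoly_of_poly -mcoeff_msupp msupp_card_restr.
    have [->|_] := eqVneq (m ord_max) 0%N; first by rewrite addn0; apply: Kp0.
    by rewrite addn1 ltnS; case: (r) Kp => // r' Kp; apply: Kp.
  have Kp' i :
      {in msupp p`_i, forall m, (r < msupp_card setT m + (i != 0%N))%N}.
    move=> m mp; have [mE iE] := mnm_joinK m i.
    have := Kp (mnmwiden m + U_(ord_max) *+ i)%MM.
    rewrite mcoeff_msupp mcoeff_mpoly_of_poly mE iE -mcoeff_msupp mp.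
    by rewrite msupp_card_restr mE iE; apply.
  split=> [m /Kp'|]; first by rewrite addn0.
  case: (r) Kp' => // r' Kp' i m /Kp' le_r'.
  by rewrite -ltnS (leq_trans le_r') // -addn1 leq_add2l leq_b1.
- by [].
- by move=> p q _; rewrite /= rmorphM subrr; exact: veronese_mem0.
Qed.

(** * Bounding Krull dimension and depth *)

Section Collapse.
Variable A : comPzRingType.
Implicit Types (s : seq A) (K : nat -> ideal A).

(* [z] has the form [x0^a0 (x1^a1 (... (u + c_r x_r) ... ) + c_0 x_0)] with [u]
   a unit, where [s = x0, ..., x_r].  Following Coquand and Lombardi, a ring
   has Krull dimension at most [r] iff every [s] of size [r + 1] collapses
   to [z = 0]. *)
Fixpoint collapses s (z : A) : Prop :=
  if s is y :: s' then
    exists a c w, collapses s' w /\ z = y ^+ a * (w + c * y)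
  else exists u, u * z = 1.

(** At each stage the power of [y] is cancelled by regularity and [c * y] is absorbed by the next
    ideal; what is left at the end is a unit. This serves both regular sequences and chains of
    primes. *)
Lemma collapses_proper K s z :
  (forall i x, (i < size s)%N -> K i x -> K i.+1 x) ->
  (forall i, (i < size s)%N -> K i.+1 s`_i) ->
  (forall i x, (i < size s)%N -> K i (s`_i * x) -> K i x) ->
  collapses s z -> K 0%N z -> K (size s) 1.
Proof.
elim: s K z => [|y s IHs] K z KS Ks reg /=.
  by move=> [u <-]; apply: ideal_memMl.
move=> [a [c [w [s_w ->]]]] Kz; apply: (IHs (K \o S) w) => //=.
- by move=> i x; apply: (KS i.+1).
- by move=> i; apply: (Ks i.+1).
- by move=> i x; apply: (reg i.+1).
have : K 0%N (w + c * y).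
  elim: a Kz => [|a IHa]; first by rewrite mul1r.
  by rewrite exprS -mulrA => /(reg 0%N)-/(_ isT)/IHa.
move=> /(KS 0%N)-/(_ isT) Kwc; rewrite -[w](addrK (c * y)).
by apply: ideal_memB => //; apply/ideal_memMl/(Ks 0%N).
Qed.

Lemma regular_sequence_collapses s : regular_sequence s -> ~ collapses s 0.
Proof.
move=> [proper reg] s0; apply: proper.
have take_mem i y : (i < size s)%N ->
    y \in take i.+1 s = (y == s`_i) || (y \in take i s).
  by move=> lti; rewrite (take_nth 0 lti) mem_rcons in_cons.
rewrite -{1}[s]take_size.
pose K i := ideal_span (fun y => y \in take i s).
apply: (collapses_proper (K := K)) s0 _.
- move=> i x lti; apply: ideal_span_min => y ys.
  by apply: ideal_span_gen; rewrite take_mem // ys orbT.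
- by move=> i lti; apply: ideal_span_gen; rewrite take_mem // eqxx.
- by move=> i x lti; apply: reg.
- exact: ideal_mem0.
Qed.

Lemma prime_chain_collapses d (c : nat -> ideal A) :
  prime_chain d c -> exists s, size s = d /\ ~ collapses s 0.
Proof.
move=> [c_prime c_lt].
(* Primality of [c i] makes an element of [c i.+1] outside [c i] regular modulo [c i]. From [d] on,
   0 is a dummy value. *)
have /choice[y yP] i : exists y, (i < d)%N -> c i.+1 y /\ ~ c i y.
  have [/c_lt[_ [y [c'y cNy]]]|_] := boolP (i < d)%N; first by exists y.
  by exists 0.
have size_y : size (mkseq y d) = d by rewrite size_mkseq.
exists (mkseq y d); split=> // y0; have [c1 _] := c_prime _ (leqnn d).
apply: c1; rewrite -[X in c X]size_y.
apply: (collapses_proper (K := c)) y0 _; rewrite ?size_y.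
- by move=> i x /c_lt[]; auto.
- by move=> i lti; rewrite nth_mkseq //; case: (yP i lti).
- move=> i x lti; rewrite nth_mkseq //; have [_ c_mul] := c_prime _ (ltnW lti).
  by case/c_mul => // ciy; case: (yP i lti).
- exact: ideal_mem0.
Qed.

End Collapse.

Lemma collapses_rmorph (A B : comPzRingType) (f : {rmorphism A -> B}) s z :
  collapses s z -> collapses (map f s) (f z).
Proof.
elim: s z => [|y s IHs] z /= => [[u uz1]|[a [c [w [s_w ->]]]]].
  by exists (f u); rewrite -rmorphM uz1 rmorph1.
exists a, (f c), (f w); split; first exact: IHs.
by rewrite rmorphM rmorphXn rmorphD rmorphM.
Qed.

Section DimensionCount.
Variables (F : fieldType) (n : nat).
Local Notation S := {mpoly F[n]}.
Implicit Types (p q : S) (s : seq S).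

Definition deg_le D p := {in msupp p, forall m, (mdeg m <= D)%N}.

Lemma deg_leM D D' p q : deg_le D p -> deg_le D' q -> deg_le (D + D') (p * q).
Proof.
move=> pD qD m /msuppM_le/allpairsP[[m1 m2] /= [/pD m1D /qD m2D ->]].
by rewrite mdegD leq_add.
Qed.

Lemma deg_leX D p a : deg_le D p -> deg_le (a * D) (p ^+ a).
Proof.
move=> pD; elim: a => [|a IHa]; last by rewrite exprS mulSn; apply: deg_leM.
by move=> m; rewrite expr0 msupp1 inE => /eqP->; rewrite mdeg0.
Qed.

(* [mon] lists the monomials in [s] with exponents below [T]: a nontrivial
   linear combination collapses [s], as one sees by factoring out its lowest
   power of the first element. *)
Lemma power_products_collapse (T D : nat) s :
  (forall p, p \in s -> deg_le D p) ->
  exists (J : finType) (mon : J -> S), [/\ #|J| = (T ^ size s)%N,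
    forall j, deg_le (size s * (T * D)) (mon j) &
    forall q : J -> F, (exists j, q j != 0) ->
      collapses s (\sum_j q j *: mon j)].
Proof.
elim: s => [_|y s IHs sD].
  exists unit, (fun=> 1); split=> [|_ m|q [[] q0]].
  - by rewrite card_unit.
  - by rewrite msupp1 inE => /eqP->; rewrite mdeg0.
  exists (q tt)^-1%:MP; rewrite (big_pred1 tt) => [|[]] //.
  by rewrite mul_mpolyC scalerA mulVf // scale1r.
have [|J [mon [cardJ monD mon_q]]] := IHs.
  by move=> p ps; apply: sD; rewrite in_cons ps orbT.
exists ('I_T * J)%type, (fun aj => y ^+ (aj.1 : 'I_T) * mon aj.2).
split=> [|[a j] /=|q [[a1 j1] q1]].
- by rewrite card_prod card_ord cardJ expnS.
- move=> m mp.
  have yD := deg_leX (a := a) (sD y (mem_head _ _)).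
  apply: leq_trans (deg_leM yD (monD j) mp) _.
  by rewrite mulSn leq_add2r leq_mul2r ltnW ?orbT.
pose P (a : 'I_T) := \sum_j q (a, j) *: mon j.
have [a0 qa0 a0_min] :=
  @arg_minnP _ a1 (fun a => [exists j, q (a, j) != 0]) (@nat_of_ord T)
    (introT existsP (ex_intro _ j1 q1)).
have P0 (a : 'I_T) : (a < a0)%N -> P a = 0.
  rewrite ltnNge; move/(contra (a0_min a)); rewrite negb_exists => /forallP qa.
  by apply: big1 => j _; have := qa j; rewrite negbK => /eqP->; rewrite scale0r.
have -> : \sum_aj q aj *: (y ^+ (aj.1 : 'I_T) * mon aj.2) =
    \sum_(a < T) y ^+ a * P a.
  transitivity (\sum_(aj : 'I_T * J) q (aj.1, aj.2) *: (y ^+ aj.1 * mon aj.2)).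
    by apply: eq_bigr => -[].
  rewrite -(pair_bigA _ (fun a j => q (a, j) *: (y ^+ (a : 'I_T) * mon j))) /=.
  apply: eq_bigr => a _; rewrite mulr_sumr; apply: eq_bigr => j _.
  by rewrite scalerAr.
(* One factor [y] is set aside for the shape [w + c * y], hence the predecessor; the exponents
   truncated by subtraction belong to [a < a0], where [P a = 0]. *)
exists a0, (\sum_(a < T | a != a0) y ^+ (a - a0).-1 * P a), (P a0); split.
  by apply: mon_q; apply/existsP.
rewrite (bigD1 a0) //= mulrDr; congr (_ + _).
rewrite mulr_suml mulr_sumr; apply: eq_bigr => a.
rewrite -val_eqE neq_ltn /= => /orP[lta|gta].
  by rewrite P0 // !(mulr0, mul0r).
rewrite [_ * P a * y]mulrAC -exprSr prednK ?subn_gt0 // mulrA -exprD.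
by rewrite subnKC // ltnW.
Qed.

(** The left side is at most [(k * (l * D).+1) ^ r * T ^ r], and [T] is chosen to exceed the first
    factor. *)
Lemma power_products_outnumber k l D r (T := ((k * (l * D).+1) ^ r).+1) :
  ((k * (l * (T * D)).+1) ^ r < T ^ r.+1)%N.
Proof.
apply: (@leq_ltn_trans ((k * (l * D).+1 * T) ^ r)); last first.
  by rewrite expnMn expnS ltn_mul2r expn_gt0 ltnS leqnn.
have T_gt0 : (0 < T)%N by [].
have [->|r_gt0] := posnP r; first by rewrite !expn0.
rewrite leq_exp2r // -mulnA leq_mul2l; apply/orP; right.
by rewrite mulSn -mulnA [(D * T)%N]mulnC -add1n leq_add2r.
Qed.

(** Pigeonhole: there are more power products of [s] than monomials of bounded degree with support
    of size at most [r]. Some nontrivial combination therefore involves only monomials with larger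
    support, and so lies in [I]. *)
Lemma exists_collapse (I : ideal S) r s :
  (forall p, veronese setT r.+1 p -> I p) -> (0 < n)%N -> size s = r.+1 ->
  exists2 p, I p & collapses s p.
Proof.
move=> VI n_gt0 size_s.
pose D := (\max_(p <- s) msize p)%N.
have sD p : p \in s -> deg_le D p.
  move=> ps m /msize_mdeg_lt/ltnW/leq_trans; apply.
  exact: (leq_bigmax_seq (F := fun p : S => msize p)).
pose T := ((n * (r.+1 * D).+1) ^ r).+1.
pose N := (r.+1 * (T * D))%N.
have [J [mon [cardJ monN mon_q]]] := power_products_collapse T sD.
rewrite size_s in cardJ monN.
(* [r] variables, possibly repeated, with exponents at most [N]: every monomial of degree at most
   [N] and support of size at most [r] is reached, perhaps several times. Smaller supports are
   padded with exponent 0. *)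
pose E : finType := ({ffun 'I_r -> 'I_n} * {ffun 'I_r -> 'I_N.+1})%type.
pose mnm (e : E) : 'X_{1..n} := (\sum_j U_(e.1 j) *+ e.2 j)%MM.
pose M : 'M[F]_(#|J|, #|E|) :=
  \matrix_(a, b) (mon (enum_val a))@_(mnm (enum_val b)).
have lt_EJ : (#|E| < #|J|)%N.
  rewrite cardJ card_prod !card_ffun !card_ord -expnMn.
  exact: power_products_outnumber.
have /rowV0Pn[v /sub_kermxP vM v0] : kermx M != 0.
  rewrite -mxrank_eq0 mxrank_ker subn_eq0 -ltnNge.
  exact: leq_ltn_trans (rank_leq_col _) lt_EJ.
exists (\sum_j v 0 (enum_rank j) *: mon j); last first.
  apply: mon_q; have [j vj] := rV0Pn _ v0.
  by exists (enum_val j); rewrite enum_valK.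
apply: VI => m mp; rewrite ltnNge; apply/negP => le_mr.
have mN : (mdeg m <= N)%N.
  have /flatten_mapP[j _ /=] := msupp_sum_le mp.
  by move=> /msuppZ_le /monN.
have [e mE] : exists e, mnm e = m.
  pose A := [set i in setT | m i != 0%N]; pose i0 := Ordinal n_gt0.
  pose g j := nth i0 (enum A) j.
  exists ([ffun j : 'I_r => g j],
    [ffun j : 'I_r => inord (if (j < #|A|)%N then m (g j) else 0%N)]).
  rewrite [RHS]multinomUE_id (bigID (mem A)) /=.
  rewrite [X in (_ + X)%MM]big1; last first.
    by move=> i; rewrite !inE negbK => /eqP->.
  rewrite addm0 -big_enum (big_nth i0) big_mkord -cardE.
  rewrite (big_ord_widen r (fun j => U_(g j) *+ m (g j))%MM) //.
  rewrite [RHS]big_mkcond; apply: eq_bigr => j _; rewrite !ffunE inordK.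
    by case: ifP.
  case: ifP => // _; rewrite ltnS (leq_trans _ mN) // mdegE.
  by rewrite (bigD1 (g j)) //= leq_addr.
move: mp; rewrite mcoeff_msupp => /eqP; apply.
have := congr1 (fun w : 'rV_ _ => w 0 (enum_rank e)) vM.
rewrite !mxE => <-; rewrite raddf_sum /=.
rewrite (reindex _ (onW_bij _ (enum_val_bij J))).
by apply: eq_bigr => a _; rewrite mcoeffZ enum_valK !mxE enum_rankK mE.
Qed.

End DimensionCount.

(** * Linear resolutions *)

Section LinearResolutions.
Variables (F : fieldType) (n : nat).
Local Notation S := {mpoly F[n]}.

Definition homog_mx d a b (M : 'M[S]_(a, b)) : Prop :=
  forall i j, M i j \is d.-homog.

Lemma homog_mx_mul d e a b c (M : 'M[S]_(a, b)) (N : 'M[S]_(b, c)) :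
  homog_mx d M -> homog_mx e N -> homog_mx (d + e) (M *m N).
Proof.
move=> Md Ne i j; rewrite mxE; apply: rpred_sum => k _; exact: dhomogM.
Qed.

Lemma homog_mx_block d a b a' b' (M1 : 'M[S]_(a, b)) (M2 : 'M[S]_(a, b'))
    (M3 : 'M[S]_(a', b)) (M4 : 'M[S]_(a', b')) :
  homog_mx d M1 -> homog_mx d M2 -> homog_mx d M3 -> homog_mx d M4 ->
  homog_mx d (block_mx M1 M2 M3 M4).
Proof.
move=> h1 h2 h3 h4 i j; rewrite mxE.
by case: (split i) => i'; rewrite mxE; case: (split j).
Qed.

Lemma homog_mx_row d a b b' (M : 'M[S]_(a, b)) (N : 'M[S]_(a, b')) :
  homog_mx d M -> homog_mx d N -> homog_mx d (row_mx M N).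
Proof. by move=> hM hN i j; rewrite mxE; case: (split j). Qed.

Lemma homog_mx_col d a a' b (M : 'M[S]_(a, b)) (N : 'M[S]_(a', b)) :
  homog_mx d M -> homog_mx d N -> homog_mx d (col_mx M N).
Proof. by move=> hM hN i j; rewrite mxE; case: (split i). Qed.

Lemma homog_mxN d a b (M : 'M[S]_(a, b)) : homog_mx d M -> homog_mx d (- M).
Proof. by move=> hM i j; rewrite mxE rpredN. Qed.

Lemma homog_mx0 d a b : homog_mx d (0 : 'M[S]_(a, b)).
Proof. by move=> i j; rewrite mxE rpred0. Qed.

Lemma homog_mx_scalar d a (x : S) : x \is d.-homog -> homog_mx d (x%:M : 'M_a).
Proof.
by move=> hx i j; rewrite mxE; case: eqP; rewrite ?mulr1n // mulr0n rpred0.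
Qed.

Lemma pihomogMr d e (p q : S) : q \is e.-homog ->
  pihomog mdeg (d + e) (p * q) = pihomog mdeg d p * q.
Proof.
move=> qe; have pE := pihomog_partitionE (mf := mdeg) (leqnn (msize p)).
have -> : pihomog mdeg d p =
    \sum_(k < msize p) pihomog mdeg d (pihomog mdeg k p).
  by rewrite -raddf_sum /= -pE.
rewrite {1}pE !mulr_suml raddf_sum; apply: eq_bigr => k _ /=.
have pqk := dhomogM (pihomogP mdeg k p) qe.
have [<-|ne_kd] := eqVneq (k : nat) d.
  by rewrite (pihomog_dE pqk) pihomog_id.
rewrite (pihomog_ne0 ne_kd (pihomogP _ _ _)) mul0r.
by rewrite (pihomog_ne0 _ pqk) // eqn_add2r.
Qed.

(** Any factorization, row by row, can be replaced by its component of degree [d], because [M] and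
    [N] are homogeneous. *)
Lemma homog_factor d e a b c (M : 'M[S]_(b, c)) (N : 'M[S]_(a, c)) :
  homog_mx e M -> homog_mx (d + e) N ->
  (forall i, exists w, row i N = w *m M) ->
  exists2 W, homog_mx d W & N = W *m M.
Proof.
move=> Me Nde /choice[w wM].
exists (\matrix_(i, j) pihomog mdeg d (w i 0 j)).
  by move=> i j; rewrite mxE pihomogP.
apply/matrixP => i j; rewrite -[LHS](pihomog_dE (Nde i j)) mxE.
have -> : N i j = \sum_k w i 0 k * M k j.
  by have := congr1 (fun v : 'rV_c => v 0 j) (wM i); rewrite !mxE.
by rewrite raddf_sum; apply: eq_bigr => k _; rewrite mxE /= pihomogMr.
Qed.

(* A resolution of the ideal [K] itself whose generators in homological degree
   [i] all have internal degree [s + i]. *)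
Record linear_resolution (K : S -> Prop) (s : nat) := LinearResolution {
  lr_rank : nat -> nat;
  lr_diff : forall i, 'M[S]_(lr_rank i.+1, lr_rank i);
  lr_aug : 'cV[S]_(lr_rank 0);
  lr_diff_homog : forall i, homog_mx 1 (lr_diff i);
  lr_aug_homog : homog_mx s lr_aug;
  lr_aug_image : forall p, K p <->
    exists v : 'rV[S]_(lr_rank 0), p = (v *m lr_aug) 0 0;
  lr_aug_exact : forall v : 'rV[S]_(lr_rank 0),
    v *m lr_aug = 0 <-> exists w, v = w *m lr_diff 0;
  lr_diff_exact : forall i (v : 'rV[S]_(lr_rank i.+1)),
    v *m lr_diff i = 0 <-> exists w, v = w *m lr_diff i.+1 }.

(** * Lifting an inclusion of ideals to a chain map *)

Section Comparison.
Variables (A B : S -> Prop) (s : nat).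
Variables (P : linear_resolution A s.+1) (Q : linear_resolution B s).
Hypothesis AB : forall p, A p -> B p.

(** Generators of [P] sit one degree above those of [Q], so degree-preserving maps have linear
    entries. The second clause is what lets [f] be extended one step further. *)
Let liftable i (f : 'M[S]_(lr_rank P i, lr_rank Q i)) : Prop :=
  homog_mx 1 f /\
  forall j, exists w, row j (lr_diff P i *m f) = w *m lr_diff Q i.

Lemma comparison_step i f : liftable f ->
  exists g, liftable g /\ lr_diff P i *m f = g *m lr_diff Q i.
Proof.
move=> [f1 /(homog_factor (@lr_diff_homog _ _ Q i) (d := 1))].
case=> [|g g1 Pf]; first exact: homog_mx_mul (@lr_diff_homog _ _ P i) f1.
exists g; split=> //; split=> // j; apply/lr_diff_exact.
rewrite -row_mul -mulmxA -Pf mulmxA.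
suff -> : lr_diff P i.+1 *m lr_diff P i = 0 by rewrite mul0mx row0.
apply/row_matrixP => k; rewrite row_mul row0; apply/lr_diff_exact.
by exists (delta_mx 0 k); rewrite -rowE.
Qed.

Lemma comparison_map :
  exists f : forall i, 'M[S]_(lr_rank P i, lr_rank Q i),
    [/\ forall i, homog_mx 1 (f i), lr_aug P = f 0%N *m lr_aug Q &
      forall i, lr_diff P i *m f i = f i.+1 *m lr_diff Q i].
Proof.
have [f0 f0P augE] : exists2 f : 'M_(lr_rank P 0, lr_rank Q 0),
    liftable f & lr_aug P = f *m lr_aug Q.
  have [|j|f f1 augE] :=
    @homog_factor 1 _ _ _ _ _ (lr_aug P) (@lr_aug_homog _ _ Q).
  - exact: lr_aug_homog.
  - have /AB/(lr_aug_image Q)[w wE] : A (lr_aug P j 0).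
      by apply/(lr_aug_image P); exists (delta_mx 0 j); rewrite -rowE mxE.
    by exists w; apply/rowP => k; rewrite !ord1 -wE mxE.
  exists f => //; split=> // j; apply/lr_aug_exact.
  rewrite -row_mul -mulmxA -augE row_mul; apply/lr_aug_exact.
  by exists (delta_mx 0 j); rewrite -rowE.
pose next i (f : {f | @liftable i f}) := cid (comparison_step (svalP f)).
pose f := fix f i : {f | @liftable i f} :=
  if i is i'.+1 then exist _ _ (svalP (next i' (f i'))).1 else exist _ _ f0P.
exists (fun i => sval (f i)); split=> // i; first by have [] := svalP (f i).
exact: (svalP (next i (f i))).2.
Qed.

End Comparison.

(** * The mapping cone *)

Section MappingCone.
Variables (A B C : S -> Prop) (s : nat) (x : S).
Variables (P : linear_resolution A s.+1) (Q : linear_resolution B s).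
Hypothesis AB : forall p, A p -> B p.
Hypothesis x_homog : x \is 1.-homog.
Hypothesis x_neq0 : x != 0.
Hypothesis xA : forall p, B p -> A (x * p) -> A p.
Hypothesis CE : forall p, C p <-> exists a b, [/\ A a, B b & p = a + x * b].

(** The third summand of the cone is [P] moved up by one homological degree, with 0 in degree 0. *)
Let shift_rank i := if i is j.+1 then lr_rank P j else 0%N.
Let shift_diff i : 'M[S]_(shift_rank i.+1, shift_rank i) :=
  match i with 0%N => 0 | j.+1 => lr_diff P j end.

Lemma linear_resolution_cone : inhabited (linear_resolution C s.+1).
Proof.
have [f [f1 f_aug f_diff]] := comparison_map P Q AB.
pose rk i := (lr_rank P i + lr_rank Q i + shift_rank i)%N.
(* The last block row sends the shifted copy of [P] by [(x, - f)] into the first two summands; the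
   sign on its own differential makes consecutive maps compose to 0. *)
pose D i : 'M[S]_(rk i.+1, rk i) :=
  block_mx (block_mx (lr_diff P i) 0 0 (lr_diff Q i)) 0
    (row_mx x%:M (- f i)) (- shift_diff i).
pose aug : 'cV[S]_(rk 0) := col_mx (col_mx (lr_aug P) (x *: lr_aug Q)) 0.
have PP i : lr_diff P i.+1 *m lr_diff P i = 0.
  apply/row_matrixP => k; rewrite row_mul row0; apply/lr_diff_exact.
  by exists (delta_mx 0 k); rewrite -rowE.
have QQ i : lr_diff Q i.+1 *m lr_diff Q i = 0.
  apply/row_matrixP => k; rewrite row_mul row0; apply/lr_diff_exact.
  by exists (delta_mx 0 k); rewrite -rowE.
have SS i : shift_diff i.+1 *m shift_diff i = 0.
  by case: i => [|i]; [exact: mulmx0 | exact: PP].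
have Paug : lr_diff P 0 *m lr_aug P = 0.
  apply/row_matrixP => k; rewrite row_mul row0; apply/lr_aug_exact.
  by exists (delta_mx 0 k); rewrite -rowE.
have Qaug : lr_diff Q 0 *m lr_aug Q = 0.
  apply/row_matrixP => k; rewrite row_mul row0; apply/lr_aug_exact.
  by exists (delta_mx 0 k); rewrite -rowE.
have mul_aug a b c : row_mx (row_mx a b) c *m aug =
    a *m lr_aug P + x *: (b *m lr_aug Q).
  by rewrite !mul_row_col mulmx0 addr0 -scalemxAr.
have mulD i a b c : row_mx (row_mx a b) c *m D i =
    row_mx (row_mx (a *m lr_diff P i + x *: c)
      (b *m lr_diff Q i - c *m f i)) (- (c *m shift_diff i)).
  rewrite /D mul_row_block mulmx0 add0r mul_row_block !mulmx0 addr0 add0r.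
  by rewrite mul_mx_row add_row_mx mul_mx_scalar !mulmxN.
have rk0 (c : 'rV[S]_(shift_rank 0)) : c = 0 by apply/rowP => - [].
have splitv i (v : 'rV[S]_(rk i)) : exists a b c, v = row_mx (row_mx a b) c.
  exists (lsubmx (lsubmx v)), (rsubmx (lsubmx v)), (rsubmx v).
  by rewrite !hsubmxK.
apply: inhabits; apply: (@LinearResolution C s.+1 rk D aug).
- move=> i; apply: homog_mx_block.
  + apply: homog_mx_block; try exact: homog_mx0; exact: lr_diff_homog.
  + exact: homog_mx0.
  + by apply: homog_mx_row; [exact: homog_mx_scalar | apply/homog_mxN/f1].
  + apply: homog_mxN; case: i => [|i]; first exact: homog_mx0.
    exact: lr_diff_homog.
- apply: homog_mx_col; last exact: homog_mx0.
  apply: homog_mx_col; first exact: lr_aug_homog.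
  by move=> i j; rewrite mxE -[s.+1]add1n dhomogM // lr_aug_homog.
- move=> p; rewrite CE; split=> [[a [b [/(lr_aug_image P)[v ->]
    /(lr_aug_image Q)[w ->] ->]]]|[v ->]].
    by exists (row_mx (row_mx v w) 0); rewrite mul_aug !mxE.
  have [a [b [c ->]]] := splitv _ v; rewrite mul_aug.
  exists ((a *m lr_aug P) 0 0), ((b *m lr_aug Q) 0 0).
  split; [by apply/(lr_aug_image P); exists a | | by rewrite !mxE].
  by apply/(lr_aug_image Q); exists b.
- move=> v; split=> [|[w ->]]; last first.
    have [a [b [c ->]]] := splitv _ w; rewrite mulD mul_aug.
    rewrite mulmxDl mulmxBl -!mulmxA Paug Qaug !mulmx0 add0r sub0r -scalemxAl.
    by rewrite f_aug scalerN subrr.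
  have [a [b [c ->]]] := splitv _ v; rewrite mul_aug => ab0.
  (* The relation puts [x] times the image of [b] in [A]; by [xA] that image is in [A] and lifts to
     [c']. Then [a + x *: c'] and [b - c' *m f 0] are cycles, and [- c'] is the third coordinate of
     the preimage. *)
  have [c' cE] : exists c', b *m lr_aug Q = c' *m lr_aug P.
    suff /(lr_aug_image P)[c' cE] : A ((b *m lr_aug Q) 0 0).
      by exists c'; apply/rowP => j; rewrite ord1.
    apply: xA; first by apply/(lr_aug_image Q); exists b.
    apply/(lr_aug_image P); exists (- a); rewrite mulNmx.
    have ab00 : (a *m lr_aug P + x *: (b *m lr_aug Q)) 0 0 = 0.
      by rewrite ab0 mxE.
    rewrite mxE [X in _ + X]mxE in ab00; rewrite [RHS]mxE; apply/eqP.
    by rewrite -addr_eq0 addrC ab00.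
  have /lr_aug_exact[u uE] : (a + x *: c') *m lr_aug P = 0.
    by rewrite mulmxDl -scalemxAl -cE.
  have /lr_aug_exact[w wE] : (b - c' *m f 0%N) *m lr_aug Q = 0.
    by rewrite mulmxBl -mulmxA -f_aug cE subrr.
  exists (row_mx (row_mx u w) (- c')); rewrite mulD -uE -wE.
  rewrite scalerN addrK mulNmx opprK subrK; congr row_mx.
  by rewrite [LHS]rk0 [RHS]rk0.
move=> i v; split=> [|[w ->]]; last first.
  have [a [b [c ->]]] := splitv _ w; rewrite !mulD.
  rewrite mulmxDl mulmxBl -!mulmxA PP QQ !mulmx0 add0r sub0r -scalemxAl.
  rewrite scalerN subrr mulNmx -mulmxA f_diff opprK addNr mulNmx opprK.
  by rewrite -mulmxA SS mulmx0 !row_mx0.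
have [a [b [c ->]]] := splitv _ v; rewrite mulD.
move=> /eqP; rewrite row_mx_eq0 row_mx_eq0.
move=> /andP[/andP[/eqP eqa /eqP eqb] /eqP eqc].
have [c' cE] : exists c', c = c' *m lr_diff P i.
  (* For [i = 0] the shifted differential is 0, so [lr_aug P] is applied to [eqa] instead: [x] times
     the image of [c] vanishes, and [x] is nonzero in a domain. *)
  case: i {v b} a c eqa eqc {eqb} => [|i] a c eqa eqc.
    apply/lr_aug_exact; have := congr1 (mulmx^~ (lr_aug P)) eqa.
    rewrite mulmxDl -mulmxA Paug mulmx0 add0r mul0mx -scalemxAl => /matrixP xc0.
    apply/matrixP => j k; have /eqP := xc0 j k.
    rewrite [X in X == _]mxE [X in _ == X]mxE mulf_eq0 (negPf x_neq0).
    by move=> /eqP->; rewrite mxE.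
  by apply/lr_diff_exact/oppr_inj; rewrite oppr0.
have /lr_diff_exact[u uE] : (a + x *: c') *m lr_diff P i = 0.
  by rewrite mulmxDl -scalemxAl -cE.
have /lr_diff_exact[w wE] : (b - c' *m f i.+1) *m lr_diff Q i = 0.
  by rewrite mulmxBl -mulmxA -f_diff mulmxA -cE.
exists (row_mx (row_mx u w) (- c')); rewrite mulD -uE -wE.
by rewrite scalerN addrK mulNmx opprK subrK mulNmx opprK cE.
Qed.

End MappingCone.
End LinearResolutions.

Section VeroneseMonomials.
Variables (F : fieldType) (n : nat).
Local Notation S := {mpoly F[n]}.
Implicit Types (U V : {set 'I_n}) (m : 'X_{1..n}) (p q : S).

Lemma msupp_card_setU1 x U m : x \notin U ->
  msupp_card (x |: U) m = ((m x != 0%N) + msupp_card U m)%N.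
Proof.
move=> xU; rewrite /msupp_card.
have [mx0|mx] /= := eqVneq (m x) 0%N.
  apply: eq_card => i; rewrite !inE.
  by have [->|] := eqVneq i x; rewrite ?mx0 ?eqxx ?andbF.
rewrite (_ : [set i in x |: U | _] = x |: [set i in U | m i != 0%N]).
  by rewrite cardsU1 inE (negPf xU).
by apply/setP => i; rewrite !inE; have [->|] := eqVneq i x; rewrite ?mx.
Qed.

Lemma eq_msupp_card U m m' :
  {in U, forall i, (m i == 0%N) = (m' i == 0%N)} ->
  msupp_card U m = msupp_card U m'.
Proof.
move=> mm'; apply: eq_card => i; rewrite !inE.
by case: (boolP (i \in U)) => // /mm'->.
Qed.

Lemma msupp_card_sub U V m :
  U \subset V -> (msupp_card U m <= msupp_card V m)%N.
Proof.
move=> /subsetP sUV; apply/subset_leq_card/subsetP => i; rewrite !inE.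
by case/andP => /sUV-> ->.
Qed.

Lemma veronese_monomials U d (Q : pred 'X_{1..n})
    (f : 'X_{1..n} -> 'X_{1..n}) p :
  {in msupp p, forall m, Q m -> (d <= msupp_card U (f m))%N} ->
  veronese U d (\sum_(m <- msupp p | Q m) p@_m *: 'X_[f m]).
Proof.
move=> Qd; rewrite big_seq_cond; apply: ideal_mem_sum => m /andP[mp Qm].
by move=> m' /msuppZ_le; rewrite msuppX inE => /eqP->; apply: Qd.
Qed.

Lemma mpoly_split (Q : pred 'X_{1..n}) p :
  p = \sum_(m <- msupp p | Q m) p@_m *: 'X_[m] +
      \sum_(m <- msupp p | ~~ Q m) p@_m *: 'X_[m].
Proof. by rewrite {1}[p]mpolyE (bigID Q). Qed.

(** This ideal is generated by the variables of [U]. Modulo it, each factor reduces to its part free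
    of these variables; a product of two such parts is again free of them, so it lies in the ideal
    only if it is 0. *)
Lemma veronese1_prime U : prime_ideal (veronese U 1 : ideal S).
Proof.
pose avoid m := msupp_card U m == 0%N.
split=> [/(_ 0%MM)|p q].
  rewrite msupp1 inE eqxx => /(_ isT); rewrite /msupp_card.
  by rewrite [X in (_ < X)%N]eq_card0 // => i; rewrite !inE mnm0E andbF.
have split_avoid (a : S) : exists a0 a1, [/\ a = a0 + a1, veronese U 1 a1 &
    {in msupp a0, forall m, avoid m}].
  exists (\sum_(m <- msupp a | avoid m) a@_m *: 'X_[m]).
  exists (\sum_(m <- msupp a | ~~ avoid m) a@_m *: 'X_[m]).
  split; first exact: mpoly_split.
    by apply: (@veronese_monomials U 1 _ id) => m _; rewrite /avoid lt0n.
  move=> m /msupp_sum_le/flatten_mapP[m']; rewrite mem_filter => /andP[avm' _].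
  by move=> /msuppZ_le; rewrite msuppX inE => /eqP->.
have [p0 [p1 [-> Vp1 av_p]]] := split_avoid p.
have [q0 [q1 [-> Vq1 av_q]]] := split_avoid q => Vpq.
have V00 : veronese U 1 (p0 * q0).
  have -> : p0 * q0 = (p0 + p1) * (q0 + q1) - (p1 * (q0 + q1) + p0 * q1).
    by rewrite mulrDl opprD addrA addrK mulrDr addrK.
  apply: ideal_memB => //; apply: ideal_memD; first exact: ideal_memMr.
  exact: ideal_memMl.
have : p0 * q0 == 0.
  apply/negP => /negP pq0; have mpq := mlead_supp pq0.
  have := V00 _ mpq; rewrite ltnNge => /negP; apply.
  have /allpairsP[[m1 m2] /= [/av_p av1 /av_q av2 ->]] := msuppM_le mpq.
  rewrite leqn0 cards_eq0; apply/eqP/setP => i; rewrite !inE mnmDE addn_eq0.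
  move: av1 av2; rewrite /avoid !cards_eq0 => /eqP/setP/(_ i) + /eqP/setP/(_ i).
  by rewrite !inE; case: (i \in U) => //= /negbFE-> /negbFE->.
by rewrite mulf_eq0 => /orP[]/eqP->; rewrite add0r; [left | right].
Qed.

(** The induction removes an element of [U] inside a fixed polynomial ring, so both smaller ideals
    live in the same ring. *)
Lemma veronese_linear_resolution U d :
  inhabited (linear_resolution (veronese U d : ideal S) d).
Proof.
have [k] := ubnP #|U|; elim: k U d => // k IHk U [_|d leUk].
  pose rk i := (i == 0)%N : nat.
  apply: inhabits; apply: (@LinearResolution _ _ _ _ rk (fun=> 0) 1%:M).
  - by move=> i; apply: homog_mx0.
  - by apply: homog_mx_scalar; apply: dhomog1.
  - move=> p; split=> // _; exists p%:M.
    by rewrite mulmx1 mxE eqxx mulr1n.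
  - move=> v; rewrite mulmx1; split=> [->|[w ->]]; last by rewrite mulmx0.
    by exists 0; rewrite mulmx0.
  - move=> i v; split=> [_|_]; last by rewrite mulmx0.
    by exists 0; apply/rowP => - [].
have [->|[x xU]] := set_0Vmem U.
  apply: inhabits.
  apply: (@LinearResolution _ _ _ _ (fun=> 0%N) (fun=> 0) 0).
  - by move=> i; apply: homog_mx0.
  - exact: homog_mx0.
  - move=> p; split=> [Vp|[v ->]]; last first.
      by rewrite mulmx0 mxE; apply: ideal_mem0.
    exists 0; rewrite mulmx0 mxE; apply/msuppnil0.
    case E: (msupp p) => [//|m ms].
    have := Vp m; rewrite E mem_head => /(_ isT).
    by rewrite /msupp_card eq_card0 // => i; rewrite !inE.
  - by move=> v; split=> _; [exists 0; apply/rowP => - [] | rewrite mulmx0].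
  - by move=> i v; split=> _; [exists 0; apply/rowP => - [] | rewrite mulmx0].
rewrite -(setD1K xU); set V := U :\ x.
have xV : x \notin V by rewrite !inE eqxx.
have ltVk : (#|V| < k)%N.
  by move: leUk; rewrite (cardsD1 x) xU add1n ltnS.
have [P] := IHk V d.+1 ltVk; have [Q] := IHk V d ltVk.
(* Since [x] is outside [V], multiplying by it leaves the support in [V] unchanged; this yields the
   colon condition of the cone as well as the decomposition of the larger ideal. *)
have shiftV m : msupp_card V (U_(x) + m)%MM = msupp_card V m.
  apply: eq_msupp_card => i iV; rewrite mnmDE mnm1E.
  by have [xi|] := eqVneq x i; [rewrite xi iV in xV | rewrite add0n].
apply: (@linear_resolution_cone _ _ _ _ _ _ 'X_x P Q).
- by move=> p; apply: veronese_anti.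
- by rewrite dhomogX /= mdeg1.
- by rewrite -msize_poly_eq0 msizeX.
- move=> p _ VXp m mp; rewrite -shiftV; apply: VXp.
  by rewrite mcoeff_msupp mulrC mcoeffMX -mcoeff_msupp.
move=> p; split=> [Vp|[a [b [Va Vb ->]]]].
  exists (\sum_(m <- msupp p | m x == 0%N) p@_m *: 'X_[m]).
  exists (\sum_(m <- msupp p | m x != 0%N) p@_m *: 'X_[m - U_(x)]); split.
  - apply: (@veronese_monomials V _ _ id) => m /Vp + /eqP mx0.
    by rewrite msupp_card_setU1 // mx0.
  - apply: (@veronese_monomials V _ _ (fun m => m - U_(x))%MM) => m /Vp + mx.
    have := shiftV (m - U_(x))%MM; rewrite addmC submK ?lep1mP // => <-.
    by rewrite msupp_card_setU1 // mx.
  rewrite [LHS](mpoly_split (fun m => m x == 0%N)); congr (_ + _).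
  rewrite mulr_sumr; apply: eq_bigr => m mx.
  by rewrite -scalerAr -mpolyXD [(U_(x) + _)%MM]addmC submK // lep1mP.
apply: ideal_memD => m.
  by move=> /Va /leq_trans; apply; apply/msupp_card_sub/subsetUr.
rewrite mulrC (perm_mem (msuppMX _ _)) => /mapP[m' /Vb le_d ->].
by rewrite msupp_card_setU1 // shiftV mnmDE mnm1E eqxx.
Qed.

End VeroneseMonomials.

(** * Stanley-Reisner rings *)

Section QuotientIdeals.
Variables (R : comPzRingType) (I P : ideal R).
Hypothesis IP : forall p, I p -> P p.

Lemma quotient_ideal_mem0 : exists p, P p /\ to_quotient I p = 0.
Proof. by exists 0; split; [exact: ideal_mem0 | exact: rmorph0]. Qed.

Lemma quotient_ideal_memD x y :
  (exists p, P p /\ to_quotient I p = x) ->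
  (exists p, P p /\ to_quotient I p = y) ->
  exists p, P p /\ to_quotient I p = x + y.
Proof.
move=> [p [Pp <-]] [q [Pq <-]]; exists (p + q).
by split; [exact: ideal_memD | exact: rmorphD].
Qed.

Lemma quotient_ideal_memMl a x :
  (exists p, P p /\ to_quotient I p = x) ->
  exists p, P p /\ to_quotient I p = a * x.
Proof.
have [b <-] := to_quotient_surj a; move=> [p [Pp <-]]; exists (b * p).
by split; [exact: ideal_memMl | exact: rmorphM].
Qed.

Definition quotient_ideal : ideal (quotient I) :=
  Ideal quotient_ideal_mem0 quotient_ideal_memD quotient_ideal_memMl.

Lemma quotient_idealE p : quotient_ideal (to_quotient I p) <-> P p.
Proof.
split=> [[q [Pq /eqP]]|Pp]; last by exists p.
rewrite -subr_eq0 -rmorphB => /eqP/to_quotient_eq0/IP Pqp.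
by rewrite -[p](subKr q); apply: ideal_memB.
Qed.

Lemma quotient_ideal_prime : prime_ideal P -> prime_ideal quotient_ideal.
Proof.
move=> [P1 Pmul]; split=> [|x y].
  by rewrite -(rmorph1 (to_quotient I)) => /quotient_idealE.
have [p <-] := to_quotient_surj x; have [q <-] := to_quotient_surj y.
rewrite -rmorphM => /quotient_idealE/Pmul[].
  by left; apply/quotient_idealE.
by right; apply/quotient_idealE.
Qed.

End QuotientIdeals.

Lemma regular_sequence_take (R : comPzRingType) (s : seq R) k :
  regular_sequence s -> regular_sequence (take k s).
Proof.
move=> [proper reg]; split=> [s1|i].
  apply: proper; apply: ideal_span_min s1 => y /mem_take ys.
  exact: ideal_span_gen.
rewrite size_take_min leq_min => /andP[ltik ltis] x.
by rewrite nth_take // take_takel 1?ltnW //; apply: reg.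
Qed.

(** * Krull dimension and depth of the quotient are both [r] *)

Section CohenMacaulay.
Variables (F : fieldType) (n r : nat) (I : ideal {mpoly F[n]}).
Hypothesis le_rn : (r < n)%N.
Hypothesis IE : forall p, I p <-> veronese setT r.+1 p.
Local Notation S := {mpoly F[n]}.

Lemma quotient_collapses (s : seq (quotient I)) :
  size s = r.+1 -> collapses s 0.
Proof.
move=> size_s.
have [|||p Ip] := @exists_collapse F n I r (map repr s).
- by move=> p /IE.
- exact: leq_ltn_trans le_rn.
- by rewrite size_map.
move=> /(collapses_rmorph (to_quotient I)); rewrite -map_comp.
rewrite [X in collapses _ X](iffRL (to_quotient_eq0 I p) Ip).
by rewrite (eq_map (g := id)) ?map_id // => q; apply: reprK.
Qed.

Lemma quotient_krull_dim : has_krull_dim (quotient I) r.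
Proof.
split.
  (* Only [r - i] variables lie outside [U i], so a monomial with more than [r] variables meets it.
     The primes generated by the [U i] increase strictly: the variable of index [r - i.+1] is new at
     step [i.+1]. *)
  pose U i := [set v : 'I_n | (r - i <= v)%N].
  have IUi i p : I p -> veronese (U i) 1 p.
    move=> /IE Ip m /Ip; rewrite /msupp_card => lt_r; apply/card_gt0P.
    apply/existsP; apply: contraLR lt_r; rewrite negb_exists => /forallP Um.
    rewrite -leqNgt cardE -(size_map val) -(size_iota 0 r).
    apply: uniq_leq_size.
      by rewrite map_inj_uniq ?enum_uniq //; apply: val_inj.
    move=> _ /mapP[v + ->]; rewrite mem_enum mem_iota !inE /= => mv.
    rewrite ltnNge; apply: contra (Um v) => le_rv.
    by rewrite !inE mv (leq_trans (leq_subr _ _)).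
  exists (fun i => quotient_ideal I (veronese (U i) 1)); split=> i le_ir.
    by apply: quotient_ideal_prime (veronese1_prime _ _); apply: IUi.
  split=> [q|].
    have [p <-] := to_quotient_surj q => /(quotient_idealE (IUi i)) Up.
    apply/(quotient_idealE (IUi i.+1)) => m /Up /leq_trans; apply.
    apply/msupp_card_sub/subsetP => v; rewrite !inE; apply: leq_trans.
    by rewrite leq_sub2l.
  have lt_v : (r - i.+1 < n)%N by rewrite (leq_ltn_trans (leq_subr _ _)).
  pose v := Ordinal lt_v.
  exists (to_quotient I 'X_v); split.
    apply/(quotient_idealE (IUi i.+1)) => m; rewrite msuppX inE => /eqP->.
    by apply/card_gt0P; exists v; rewrite !inE mnm1E eqxx leqnn.
  move=> /(quotient_idealE (IUi i))/(_ U_(v)%MM).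
  rewrite msuppX inE eqxx => /(_ isT)/card_gt0P[j]; rewrite !inE mnm1E.
  case: (v =P j) => [<-|_]; last by rewrite andbF.
  by rewrite /= andbT leqNgt subnS prednK ?subn_gt0 ?leqnn.
move=> d c c_chain; rewrite leqNgt; apply/negP => lt_rd.
have [|s [size_s]] := @prime_chain_collapses _ r.+1 c.
  have [c_prime c_lt] := c_chain.
  by split=> i lti; [apply: c_prime | apply: c_lt]; apply: leq_trans lt_rd.
by apply; apply: quotient_collapses.
Qed.

Lemma to_quotient_irrelevant p :
  p@_0%MM = 0 -> irrelevant_ideal I (to_quotient I p).
Proof.
move=> p0; rewrite [p]mpolyE rmorph_sum big_seq; apply: ideal_mem_sum => m mp.
have [v mv] : exists v, m v != 0%N.
  apply/existsP; apply: contraTT mp; rewrite negb_exists => /forallP m0.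
  rewrite mcoeff_msupp negbK (_ : m = 0%MM) ?p0 //.
  by apply/mnmP => v; rewrite mnm0E; apply/eqP; rewrite -[_ == _]negbK m0.
rewrite /= -mul_mpolyC -[m](submK (m := U_(v))) ?lep1mP //.
rewrite mpolyXD mulrA rmorphM.
by apply: span_memMl; apply: ideal_span_gen; exists v.
Qed.

Lemma irrelevant_ideal_proper : ~ irrelevant_ideal I 1.
Proof.
pose M := quotient_ideal I (veronese setT 1).
have IM p : I p -> veronese setT 1 p by move=> /IE; apply: veronese_anti.
have sub : forall q, irrelevant_ideal I q -> M q.
  apply: ideal_span_min => _ [v ->]; apply/(quotient_idealE IM) => m.
  rewrite msuppX inE => /eqP->.
  by apply/card_gt0P; exists v; rewrite !inE mnm1E eqxx.
move=> /sub; rewrite -(rmorph1 (to_quotient I)) => /(quotient_idealE IM) V1.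
by have [] := veronese1_prime F (setT : {set 'I_n}).
Qed.

Lemma quotient_depth : has_depth (irrelevant_ideal I) r.
Proof.
split; last first.
  move=> s s_reg _; rewrite leqNgt; apply/negP => lt_rs.
  apply: (regular_sequence_collapses (regular_sequence_take r.+1 s_reg)).
  by apply: quotient_collapses; rewrite size_takel.
have [h [h0 hS h_reg]] := mpoly_regular_sequence F n.
have h_irr y : y \in map (to_quotient I \o h) (iota 1 r) ->
    irrelevant_ideal I y.
  case/mapP => j; rewrite mem_iota => /andP[j_gt0 _] ->.
  by apply: to_quotient_irrelevant; case: j j_gt0.
exists (map (to_quotient I \o h) (iota 1 r)); split=> //; last first.
  by rewrite size_map size_iota.
split=> [h1|].
  exact/irrelevant_ideal_proper/(ideal_span_min h_irr).
(* Regularity on [S / I] over [S] is transported to regularity modulo the zero ideal of the quotient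
   ring. *)
suff : weakly_regular (ideal_span (fun y => y \in [::])) (idealT (quotient I))
    (map (to_quotient I \o h) (iota 1 r)).
  exact: weakly_regular_span.
have span0 (q : quotient I) : ideal_span (fun y => y \in [::]) q <-> q = 0.
  split=> [[k [c [g [g0 ->]]]]|->]; last exact: ideal_mem0.
  by case: k c g g0 => [|k] c g g0; [rewrite big_ord0 | have := g0 ord0].
apply: (@weakly_regular_iso _ _
  (to_quotient I : {additive S -> quotient I}) _ h)
  (h_reg r 0%N (ltnW le_rn)) => //.
- move=> q _; have [p <-] := to_quotient_surj q.
  by exists p, 0; rewrite addr0; split=> //; apply/span0.
- by move=> p _; rewrite span0 to_quotient_eq0; apply: iff_sym; apply: IE.
- by move=> j p _; apply/span0; rewrite /= rmorphM subrr.
Qed.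

Lemma quotient_cohen_macaulay : cohen_macaulay I.
Proof.
by exists r; split; [exact: quotient_krull_dim | exact: quotient_depth].
Qed.

End CohenMacaulay.

Section LinearQuotient.
Variables (F : fieldType) (n s : nat) (I : ideal {mpoly F[n]}).
Local Notation S := {mpoly F[n]}.
Variable P : linear_resolution I s.

(** A copy of [S] in degree 0 is put in front, turning a resolution of [I] into one of [S / I] and
    shifting homological degrees by one. *)
Let rk i := if i is j.+1 then lr_rank P j else 1%N.
Let dg i (_ : 'I_(rk i)) := if i is j.+1 then (s + j)%N else 0%N.
Let D i : 'M[S]_(rk i.+1, rk i) :=
  match i with 0%N => lr_aug P | j.+1 => lr_diff P j end.

Lemma linear_graded_resolution :
  {Q : graded_resolution I | forall i (a : 'I_(rank Q i.+1)),
    @deg _ _ _ Q i.+1 a = (s + i)%N}.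
Proof.
have D_homog i (a : 'I_(rk i.+1)) (b : 'I_(rk i)) m :
    m \in msupp (D i a b) -> (mdeg m + dg b = dg a)%N.
  case: i a b => [|i] a b /=.
    have /dhomogP P_homog := @lr_aug_homog _ _ _ _ P a b.
    by move=> /P_homog /= ->.
  have /dhomogP P_homog := @lr_diff_homog _ _ _ _ P i a b.
  by move=> /P_homog /= ->; rewrite add1n addnS.
have aug_homog (a : 'I_(rk 0)) : (1%:M : 'cV[S]_(rk 0)) a 0 \is (dg a).-homog.
  by rewrite ord1 mxE eqxx mulr1n; apply: dhomog1.
have aug_surj (q : quotient I) :
    exists v : 'rV[S]_(rk 0), to_quotient I ((v *m 1%:M) 0 0) = q.
  have [p <-] := to_quotient_surj q; exists p%:M.
  by rewrite mulmx1 mxE eqxx mulr1n.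
have aug_exact (v : 'rV[S]_(rk 0)) :
    to_quotient I ((v *m 1%:M) 0 0) = 0 <-> exists w, v = w *m D 0%N.
  rewrite mulmx1 to_quotient_eq0 (lr_aug_image P).
  split=> [[w vE]|[w ->]]; exists w => //.
  by apply/rowP => j; rewrite ord1.
have D_exact i (v : 'rV[S]_(rk i.+1)) :
    v *m D i = 0 <-> exists w, v = w *m D i.+1.
  by case: i v => [|i] v; [exact: lr_aug_exact | exact: lr_diff_exact].
by exists (GradedResolution D_homog aug_homog aug_surj aug_exact D_exact).
Qed.

Lemma linear_resolution_quotient : has_s_linear_resolution s I.
Proof.
split=> [p /(lr_aug_image P)[v ->]|[|i] j // _ neq_j].
  rewrite mxE; apply: ideal_mem_sum => k _; apply/ideal_memMl/ideal_span_gen.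
  split; last exact: lr_aug_homog.
  by apply/(lr_aug_image P); exists (delta_mx 0 k); rewrite -rowE mxE.
have [Q degQ] := linear_graded_resolution; exists Q; rewrite /tor_dim.
suff -> : degree_part Q i.+1 j = 0 by rewrite capmx0 mxrank0.
apply/matrixP => a b; rewrite !mxE degQ.
case: eqP => [ijE|_]; last by rewrite mul0rn.
by case: neq_j; rewrite -ijE addnS subn1.
Qed.

End LinearQuotient.

(** A monomial whose support [A] has at least [d] elements is divisible by the product of the
    variables in [A], a generator because [A] is a nonface. *)
Lemma stanley_reisner_veronese (F : fieldType) n d (D : complex n) :
  (forall A, (A \notin faces D) = (d <= #|A|)%N) ->
  forall p : {mpoly F[n]}, stanley_reisner_ideal F D p <-> veronese setT d p.
Proof.
move=> nface p; split.
  apply: ideal_span_min => _ [A [/[!nface] leA ->]] m.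
  rewrite mprodXE msuppX inE => /eqP->; apply: leq_trans leA _.
  apply/subset_leq_card/subsetP => v vA; rewrite !inE /= mnm_sumE (bigD1 v) //=.
  by rewrite mnm1E eqxx.
move=> Vp; rewrite [p]mpolyE big_seq; apply: ideal_mem_sum => m /Vp le_dm.
pose A := [set v in setT | m v != 0%N].
have Am : (\sum_(v in A) U_(v) <= m)%MM.
  apply/mnm_lepP => v; rewrite mnm_sumE.
  have [vA|vA] := boolP (v \in A).
    rewrite (bigD1 v) //= mnm1E eqxx big1 => [|u /andP[_ /negPf uv]].
      by move: vA; rewrite !inE /= -lt0n.
    by rewrite mnm1E uv.
  by rewrite big1 // => u uA; rewrite mnm1E; case: eqP vA => // <-; rewrite uA.
rewrite -mul_mpolyC -(submK Am) mpolyXD mulrA.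
apply/ideal_memMl/ideal_span_gen; exists A; rewrite nface; split=> //.
by rewrite mprodXE.
Qed.

Lemma veronese_cm_linear (F : fieldType) n d (D : complex n)
    (I := stanley_reisner_ideal F D) :
  (0 < d <= n)%N -> (forall A, (A \notin faces D) = (d <= #|A|)%N) ->
  cohen_macaulay I /\ has_linear_resolution I.
Proof.
case: d => // d lt_dn nface.
have IE := @stanley_reisner_veronese F n _ D nface.
split; first exact: quotient_cohen_macaulay lt_dn IE.
have [P] := veronese_linear_resolution F (setT : {set 'I_n}) d.+1.
exists d.+1; split=> //; apply: linear_resolution_quotient.
(* The two ideals have equivalent membership without being equal as records, so the resolution is
   repackaged with its image condition rewritten. *)
case: P => rk D' aug D1 aug1 augI aug_ex D_ex.
by apply: (LinearResolution D1 aug1 _ aug_ex D_ex) => p; rewrite IE augI.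
Qed.

Theorem theorem16 (F : fieldType) (n k : nat) (hk : (2 <= k)%N)
    (hkn : (k <= n)%N) :
  let D := total_cut_complex (edgeless_graph n) k in
  let I := stanley_reisner_ideal F D in
  let J := stanley_reisner_ideal F (alexander_dual D) in
  (cohen_macaulay I /\ has_linear_resolution I) /\
  (cohen_macaulay J /\ has_linear_resolution J).
Proof.
move=> D I J.
(* Every vertex set is independent here, so [A] is a face as soon as its complement contains some
   [k] elements. *)
have faceE A : (A \in faces D) = (k <= #|~: A|)%N.
  rewrite inE; apply/existsP/idP => [[M /and3P[_ /eqP<- sAM]]|].
    by apply: subset_leq_card; rewrite -setCS setCK.
  case/card_geqP => s [uniq_s size_s s_sub].
  exists [set x in s]; apply/and3P; split.
  - by apply/forall_inP => x _; apply/forall_inP.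
  - by rewrite cardsE (card_uniqP uniq_s) size_s.
  by apply/subsetP => x xA; rewrite !inE; apply/negP => /s_sub; rewrite inE xA.
split.
  (* [A] is a nonface when fewer than [k] elements lie outside it, that is when [A] has more than
     [n - k] elements. *)
  apply: (@veronese_cm_linear F n (n - k).+1).
    by rewrite ltn_subrL (leq_trans _ hk) // (leq_trans _ hkn) // ltnW.
  move=> A; rewrite faceE -ltnNge cardsCs setCK card_ord.
  have leA : (#|A| <= n)%N by rewrite (leq_trans (max_card _)) ?card_ord.
  by rewrite !ltn_subLR // addnC.
(* [A] is a nonface of the dual when its complement is a face of [D], that is when [A] itself has at
   least [k] elements. *)
apply: (@veronese_cm_linear F n k); first by rewrite hkn ltnW.
by move=> A; rewrite inE negbK faceE setCK.
Qed.
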